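(* Let $\mathbf A$ be a finite algebra from a congruence modular variety with $\mathrm{typ}\{\mathbf A\}\subseteq\{2,4\}$, and suppose there is a congruence $\beta\in\mathrm{Con}(\mathbf A)$ such that $\mathrm{typ}\{\mathbf A/\beta\}=\{4\}$, every prime quotient $\gamma\prec\delta$ with $\delta\le\beta$ has type 2, and $\mathbf A/\beta$ is a subdirect product of totally ordered algebras. Then $\mathrm{nuP}_{\mathbf A}\subseteq\mathsf{nuItDet}\circ\mathrm{MONOTONE}$, and in particular $\mathrm{nuP}_{\mathbf A}\subseteq\mathsf{NC}^2\circ\mathrm{MONOTONE}$.
   Context: A finite algebra has finite universe and finitely many basic operations. An $n$-ary circuit over $\mathbf A$ is a DAG with one output node, sources labelled by variables or constants from $A$, gates labelled by basic operations; size is nodes plus edges. A NuDFA over $\mathbf A$ is $(\{t_n\}_{n\ge1},\iota,S)$ with $t_n$ an $n$-ary circuit, $\iota:\{0,1\}\to A$, $S\subseteq A$, accepting $b\in\{0,1\}^n$ iff $t_n(\iota(b_1),\dots,\iota(b_n))\in S$; polynomial size means size of $t_n$ polynomial in $n$; $\mathrm{nuP}_{\mathbf A}$ is the class of languages over $\{0,1\}$ accepted by polynomial-size NuDFAs over $\mathbf A$. $\mathrm{typ}\{\mathbf A\}$ is the set of tame congruence theory types of prime quotients of $\mathbf A$. An algebra is totally ordered if some total order on its universe is preserved by all its operations. An ABP over $\mathrm{GF}(p)$ is a directed acyclic multigraph with one source and one sink, edges labelled by variables or constants of $\mathrm{GF}(p)$, computing the sum over source–sink paths of the products of labels; size is vertices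 plus edges. A $\mathrm{BABP}_p$ gate is labelled by an ABP over $\mathrm{GF}(p)$ and $T\subseteq\mathrm{GF}(p)$ and outputs 1 on Boolean inputs iff the polynomial value lies in $T$; its size is the ABP's size. $\mathsf{nuItDet}\circ\mathrm{MONOTONE}$ is the class of languages $L$ for which there are primes $p_1,\dots,p_h$ such that for each $n$, $L\cap\{0,1\}^n$ is recognized by a layered circuit with a single top $\mathrm{BABP}_{p_1}$ gate, layer $i$ consisting of $\mathrm{BABP}_{p_i}$ gates fed by layer $i+1$, and the bottom layer of $\mathrm{BABP}_{p_h}$ gates fed by monotone circuits (fan-in-2 $\wedge,\vee$ gates only) on the input bits, of total size polynomial in $n$. $\mathsf{NC}^2\circ\mathrm{MONOTONE}$ is defined analogously with a nonuniform $\mathsf{NC}^2$ circuit (polynomial size, depth $O(\log^2 n)$, fan-in-2 $\wedge,\vee$ and $\neg$) on top of polynomial-size monotone circuits. *)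

(* Defs.v *)
From HB Require Import structures.
From mathcomp Require Import all_boot all_order all_algebra.
Set Implicit Arguments. Unset Strict Implicit. Unset Printing Implicit Defensive.
Import GRing.Theory.

Section Sig.
Variables (I : finType) (ar : I -> nat).

Record alg := Alg { acar : Type; aops : forall i : I, ('I_(ar i) -> acar) -> acar }.
Record finAlg := FinAlg { fcar : finType; fops : forall i : I, ('I_(ar i) -> fcar) -> fcar }.
Definition alg_of (A : finAlg) : alg := @Alg (fcar A) (@fops A).

Inductive term : Type := TVar of nat | TOp (i : I) of ('I_(ar i) -> term).
Fixpoint teval (T : Type) (ops : forall i, ('I_(ar i) -> T) -> T) (v : nat -> T)
  (t : term) : T :=
  match t with TVar j => v j | TOp i ts => ops i (fun k => teval ops v (ts k)) end.

Inductive pterm (T : Type) : Type :=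
  PVar of nat | PCst of T | POp (i : I) of ('I_(ar i) -> pterm T).
Fixpoint pteval (T : Type) (ops : forall i, ('I_(ar i) -> T) -> T) (v : nat -> T)
  (t : pterm T) : T :=
  match t with
  | PVar j => v j | PCst c => c
  | POp i ts => ops i (fun k => pteval ops v (ts k)) end.

Definition satisfies (B : alg) (s t : term) :=
  forall v : nat -> acar B, teval (@aops B) v s = teval (@aops B) v t.
(* B lies in the variety generated by A (= Mod Id(A), Birkhoff) *)
Definition in_variety_of (A : finAlg) (B : alg) :=
  forall s t, satisfies (alg_of A) s t -> satisfies B s t.
Definition gcon (B : alg) (r : acar B -> acar B -> Prop) :=
  (forall x, r x x) /\ (forall x y, r x y -> r y x) /\
  (forall x y z, r x y -> r y z -> r x z) /\
  (forall i (x y : 'I_(ar i) -> acar B), (forall k, r (x k) (y k)) ->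
     r (@aops B i x) (@aops B i y)).
Definition con_meet (B : alg) (r s : acar B -> acar B -> Prop) :=
  fun x y => r x y /\ s x y.
Definition con_join (B : alg) (r s : acar B -> acar B -> Prop) :=
  fun x y => forall th, gcon th -> (forall a b, r a b -> th a b) ->
                        (forall a b, s a b -> th a b) -> th x y.
Definition con_modular (B : alg) :=
  forall a b c : acar B -> acar B -> Prop, gcon a -> gcon b -> gcon c ->
  (forall x y, a x y -> c x y) ->
  forall x y, con_join a (con_meet b c) x y <-> con_meet (con_join a b) c x y.
Definition cm_variety (A : finAlg) :=
  forall B : alg, in_variety_of A B -> con_modular B.

Definition is_con (A : finAlg) (r : rel (fcar A)) :=
  [/\ reflexive r, symmetric r, transitive r &
      forall i (x y : 'I_(ar i) -> fcar A), (forall k, r (x k) (y k)) ->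
        r (@fops A i x) (@fops A i y)].
Arguments is_con : clear implicits.
Definition prime_quot (A : finAlg) (a b : rel (fcar A)) :=
  [/\ is_con A a, is_con A b, subrel a b, ~ subrel b a &
      forall c, is_con A c -> subrel a c -> subrel c b -> subrel c a \/ subrel b c].
Arguments prime_quot : clear implicits.

Definition upol (A : finAlg) (t : pterm (fcar A)) : fcar A -> fcar A :=
  fun x => pteval (@fops A) (fun _ => x) t.
Definition in_U (A : finAlg) (a b : rel (fcar A)) (U : {set fcar A}) :=
  exists t, U = [set upol t x | x : fcar A] /\
            exists x y, b x y /\ ~~ a (upol t x) (upol t y).
Arguments in_U : clear implicits.
Definition minimal_set (A : finAlg) (a b : rel (fcar A)) (U : {set fcar A}) :=
  in_U A a b U /\ forall U', in_U A a b U' -> U' \subset U -> U' = U.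
Arguments minimal_set : clear implicits.
Definition is_trace (A : finAlg) (a b : rel (fcar A)) (U N : {set fcar A}) :=
  exists u, [/\ u \in U, N = U :&: [set y | b u y] &
                exists x y, [/\ x \in N, y \in N & ~~ a x y]].
Arguments is_trace : clear implicits.
Definition induced (A : finAlg) (N : {set fcar A}) (t : pterm (fcar A)) :=
  forall v : nat -> fcar A, (forall j, v j \in N) -> pteval (@fops A) v t \in N.
Definition onN (A : finAlg) (N : {set fcar A}) (v : nat -> fcar A) :=
  forall j, v j \in N.

Inductive lterm := LVar of nat | LCst of bool | LAnd of lterm & lterm
                 | LOr of lterm & lterm.
Fixpoint leval (v : nat -> bool) (t : lterm) : bool :=
  match t with LVar j => v j | LCst c => c
  | LAnd s u => leval v s && leval v u | LOr s u => leval v s || leval v u end.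

Inductive vterm (F : finFieldType) (d : nat) :=
  VVar of nat | VCst of 'rV[F]_d | VZero | VAdd of vterm F d & vterm F d
| VOpp of vterm F d | VScale of F & vterm F d.
Fixpoint veval (F : finFieldType) (d : nat) (v : nat -> 'rV[F]_d) (t : vterm F d)
  : 'rV[F]_d :=
  match t with
  | VVar j => v j | VCst c => c | VZero => 0%R
  | VAdd s u => (veval v s + veval v u)%R | VOpp s => (- veval v s)%R
  | VScale r s => (r *: veval v s)%R end.

(* typ(a,b) = 4: for an (a,b)-minimal set U and a trace N, the algebra
   A|_N / a|_N is polynomially equivalent to the two-element lattice
   (the bijection N/a -> bool being induced by phi). *)
Definition type4 (A : finAlg) (a b : rel (fcar A)) :=
  exists (U N : {set fcar A}) (phi : fcar A -> bool),
  minimal_set A a b U /\ is_trace A a b U N /\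
  (forall x y, x \in N -> y \in N -> (phi x == phi y) = a x y) /\
  (forall c : bool, exists2 x, x \in N & phi x = c) /\
  (forall t, induced N t -> exists s : lterm, forall v, onN N v ->
      phi (pteval (@fops A) v t) = leval (fun j => phi (v j)) s) /\
  (exists t, induced N t /\ forall v, onN N v ->
      phi (pteval (@fops A) v t) = phi (v 0%N) && phi (v 1%N)) /\
  (exists t, induced N t /\ forall v, onN N v ->
      phi (pteval (@fops A) v t) = phi (v 0%N) || phi (v 1%N)).
Arguments type4 : clear implicits.

(* typ(a,b) = 2: A|_N / a|_N is polynomially equivalent to a vector space
   over a finite field. *)
Definition type2 (A : finAlg) (a b : rel (fcar A)) :=
  exists (U N : {set fcar A}) (F : finFieldType) (d : nat) (phi : fcar A -> 'rV[F]_d),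
  minimal_set A a b U /\ is_trace A a b U N /\
  (forall x y, x \in N -> y \in N -> (phi x == phi y) = a x y) /\
  (forall w : 'rV[F]_d, exists2 x, x \in N & phi x = w) /\
  (forall t, induced N t -> exists s : vterm F d, forall v, onN N v ->
      phi (pteval (@fops A) v t) = veval (fun j => phi (v j)) s) /\
  (exists t, induced N t /\ forall v, onN N v ->
      phi (pteval (@fops A) v t) = (phi (v 0%N) + phi (v 1%N))%R) /\
  (exists t, induced N t /\ forall v, onN N v ->
      phi (pteval (@fops A) v t) = (- phi (v 0%N))%R) /\
  (exists t, induced N t /\ forall v, onN N v -> phi (pteval (@fops A) v t) = 0%R) /\
  (forall r : F, exists t, induced N t /\ forall v, onN N v ->
      phi (pteval (@fops A) v t) = (r *: phi (v 0%N))%R).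
Arguments type2 : clear implicits.

Definition typ_sub24 (A : finAlg) :=
  forall a b, prime_quot A a b -> type2 A a b \/ type4 A a b.
Definition typ_eq4 (A : finAlg) :=
  (exists a b, prime_quot A a b) /\ forall a b, prime_quot A a b -> type4 A a b.

Section Quot.
Variables (A : finAlg) (th : rel (fcar A)).
Definition qcar := {C : {set fcar A} | [exists x, C == [set y | th x y]]}.
Lemma qproj_proof (x : fcar A) : [exists z, [set y | th x y] == [set y | th z y]].
Proof. by apply/existsP; exists x. Qed.
Definition qproj (x : fcar A) : qcar := exist _ [set y | th x y] (qproj_proof x).
Definition qrep (q : qcar) : fcar A := xchoose (elimT existsP (valP q)).
Definition qops (i : I) (x : 'I_(ar i) -> qcar) : qcar :=
  qproj (@fops A i (fun k => qrep (x k))).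
Definition quot : finAlg := @FinAlg qcar qops.
End Quot.

Definition tot_ordered (B : alg) :=
  exists le : acar B -> acar B -> Prop,
  (forall x, le x x) /\ (forall x y, le x y -> le y x -> x = y) /\
  (forall x y z, le x y -> le y z -> le x z) /\ (forall x y, le x y \/ le y x) /\
  (forall i (x y : 'I_(ar i) -> acar B), (forall k, le (x k) (y k)) ->
     le (@aops B i x) (@aops B i y)).
Definition subdirect_tot (Q : finAlg) :=
  exists (J : Type) (B : J -> alg) (h : fcar Q -> forall j, acar (B j)),
  (forall j, tot_ordered (B j)) /\
  (forall q1 q2, (forall j, h q1 j = h q2 j) -> q1 = q2) /\
  (forall i (x : 'I_(ar i) -> fcar Q) j,
      h (@fops Q i x) j = @aops (B j) i (fun k => h (x k) j)) /\
  (forall j (y : acar (B j)), exists q, h q j = y).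

(* a circuit is a straight-line program (topologically sorted DAG);
   the output node is the last one *)
Inductive cnode (A : finAlg) :=
  CVar of nat | CConst of fcar A | COp (i : I) of ('I_(ar i) -> nat).
Definition cnode_val (A : finAlg) (d : fcar A) (x : nat -> fcar A)
  (vs : seq (fcar A)) (nd : cnode A) : fcar A :=
  match nd with CVar j => x j | CConst a => a
  | COp i args => @fops A i (fun k => nth d vs (args k)) end.
Definition cvals (A : finAlg) d x (c : seq (cnode A)) : seq (fcar A) :=
  foldl (fun vs nd => rcons vs (cnode_val d x vs nd)) [::] c.
Definition cout (A : finAlg) d x (c : seq (cnode A)) : fcar A := last d (cvals d x c).
Definition cnode_wf (A : finAlg) (n k : nat) (nd : cnode A) : bool :=
  match nd with CVar j => j < n | CConst _ => true
  | COp i args => [forall m, args m < k] end.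
Definition circ_wf (A : finAlg) (n : nat) (c : seq (cnode A)) :=
  0 < size c /\ forall k, k < size c -> cnode_wf n k (nth (@CVar A 0) c k).
(* size = nodes + edges *)
Definition circ_size (A : finAlg) (c : seq (cnode A)) : nat :=
  size c + \sum_(nd <- c) (if nd is COp i _ then ar i else 0).

Definition lang := seq bool -> Prop.

Definition nudfa_accepts (A : finAlg) (t : nat -> seq (cnode A))
  (io : bool -> fcar A) (S : {set fcar A}) (b : seq bool) : bool :=
  cout (io false) (fun j => io (nth false b j)) (t (size b)) \in S.

(* nuP_A (NuDFAs only read words of length n >= 1) *)
Definition nuP (A : finAlg) (L : lang) :=
  exists (t : nat -> seq (cnode A)) (io : bool -> fcar A) (S : {set fcar A}),
  (exists c e, forall n, 0 < n -> circ_wf n (t n) /\ circ_size (t n) <= c * n ^ e + c) /\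
  forall b, 0 < size b -> (L b <-> nudfa_accepts t io S b).
End Sig.
Arguments is_con {I ar} A r.
Arguments prime_quot {I ar} A a b.
Arguments in_U {I ar} A a b U.
Arguments minimal_set {I ar} A a b U.
Arguments is_trace {I ar} A a b U N.
Arguments type4 {I ar} A a b.
Arguments type2 {I ar} A a b.
Arguments quot {I ar} A th.

Inductive mnode := MIn of nat | MAnd of nat & nat | MOr of nat & nat.
Definition mnode_val (x : nat -> bool) (vs : seq bool) (nd : mnode) : bool :=
  match nd with MIn j => x j
  | MAnd a b => nth false vs a && nth false vs b
  | MOr a b => nth false vs a || nth false vs b end.
Definition mvals (x : nat -> bool) (c : seq mnode) : seq bool :=
  foldl (fun vs nd => rcons vs (mnode_val x vs nd)) [::] c.
Definition mnode_wf (n k : nat) (nd : mnode) : bool :=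
  match nd with MIn j => j < n | MAnd a b => (a < k) && (b < k)
  | MOr a b => (a < k) && (b < k) end.
Definition mcirc_wf (n : nat) (c : seq mnode) :=
  forall k, k < size c -> mnode_wf n k (nth (MIn 0) c k).
Definition msize (c : seq mnode) : nat :=
  size c + \sum_(nd <- c) (if nd is MIn _ then 0 else 2).

(* vertices 0..nv-1 (topologically ordered), source 0, sink nv-1;
   edge (u, v, label) with u < v; AVar j is the j-th input of the gate *)
Inductive alabel (p : nat) := AVar of nat | ACst of 'F_p.
Record babp (p : nat) :=
  Babp { bnv : nat; bedges : seq (nat * nat * alabel p); btarget : {set 'F_p} }.
Definition alab_val (p : nat) (y : nat -> bool) (l : alabel p) : 'F_p :=
  match l with AVar j => ((y j : nat)%:R)%R | ACst c => c end.
(* value at vertex k = sum over source-k paths of products of labels *)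
Fixpoint abp_vals (p : nat) (E : seq (nat * nat * alabel p)) (y : nat -> bool)
  (k : nat) : seq 'F_p :=
  match k with
  | 0 => [::]
  | k'.+1 => let vs := abp_vals E y k' in
      rcons vs (if k' == 0 then 1%R
                else (\sum_(e <- E | e.1.2 == k') nth 0%R vs e.1.1 * alab_val y e.2)%R)
  end.
Definition babp_value (p : nat) (g : babp p) (y : nat -> bool) : 'F_p :=
  nth 0%R (abp_vals (bedges g) y (bnv g)) (bnv g).-1.
Definition babp_eval (p : nat) (y : nat -> bool) (g : babp p) : bool :=
  babp_value g y \in btarget g.
Definition babp_wf (p m : nat) (g : babp p) : bool :=
  (0 < bnv g) &&
  all (fun e => (e.1.1 < e.1.2) && (e.1.2 < bnv g) &&
                (if e.2 is AVar j then j < m else true)) (bedges g).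
Definition babp_size (p : nat) (g : babp p) : nat := bnv g + size (bedges g).

(* layered circuit: layer k (0-based, k < size ps) consists of BABP_{ps_k}
   gates reading outputs of layer k+1; the last layer reads the nodes of the
   monotone circuit imono *)
Record itcirc (ps : seq nat) :=
  ItCirc { imono : seq mnode; ilayers : forall k : nat, seq (babp (nth 2 ps k)) }.
Fixpoint it_vals (ps : seq nat) (C : itcirc ps) (x : nat -> bool) (m : nat)
  : seq bool :=
  match m with
  | 0 => mvals x (imono C)
  | m'.+1 => let ys := it_vals C x m' in
      map (babp_eval (fun j => nth false ys j)) (ilayers C (size ps - m))
  end.
Definition it_accepts (ps : seq nat) (C : itcirc ps) (b : seq bool) : bool :=
  nth false (it_vals C (fun j => nth false b j) (size ps)) 0.
Definition it_wf (ps : seq nat) (n : nat) (C : itcirc ps) :=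
  [/\ size (ilayers C 0) = 1, mcirc_wf n (imono C) &
      forall k, k < size ps ->
        all (babp_wf (if k.+1 < size ps then size (ilayers C k.+1)
                      else size (imono C))) (ilayers C k)].
Definition it_size (ps : seq nat) (C : itcirc ps) : nat :=
  msize (imono C) + \sum_(k < size ps) \sum_(g <- ilayers C k) babp_size g.

Definition nuItDet_MONOTONE (L : lang) :=
  exists ps : seq nat, 0 < size ps /\ all prime ps /\
  exists (C : forall n : nat, itcirc ps) (c e : nat),
  forall n, 0 < n ->
    it_wf n (C n) /\ it_size (C n) <= c * n ^ e + c /\
    forall b, size b = n -> (L b <-> it_accepts (C n) b).

(* NLeaf j reads node j of the monotone circuit *)
Inductive nnode := NLeaf of nat | NNot of nat | NAnd of nat & nat | NOr of nat & nat.
Record nccirc := NcCirc { nmono : seq mnode; ngates : seq nnode }.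
Definition nnode_val (ms vs : seq bool) (nd : nnode) : bool :=
  match nd with NLeaf j => nth false ms j | NNot a => ~~ nth false vs a
  | NAnd a b => nth false vs a && nth false vs b
  | NOr a b => nth false vs a || nth false vs b end.
Definition nvals (ms : seq bool) (c : seq nnode) : seq bool :=
  foldl (fun vs nd => rcons vs (nnode_val ms vs nd)) [::] c.
Definition nnode_depth (ds : seq nat) (nd : nnode) : nat :=
  match nd with NLeaf _ => 0 | NNot a => (nth 0 ds a).+1
  | NAnd a b => (maxn (nth 0 ds a) (nth 0 ds b)).+1
  | NOr a b => (maxn (nth 0 ds a) (nth 0 ds b)).+1 end.
Definition ndepths (c : seq nnode) : seq nat :=
  foldl (fun ds nd => rcons ds (nnode_depth ds nd)) [::] c.
Definition nc_accepts (C : nccirc) (b : seq bool) : bool :=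
  last false (nvals (mvals (fun j => nth false b j) (nmono C)) (ngates C)).
Definition nc_depth (C : nccirc) : nat := last 0 (ndepths (ngates C)).
Definition nnode_wf (m k : nat) (nd : nnode) : bool :=
  match nd with NLeaf j => j < m | NNot a => a < k
  | NAnd a b => (a < k) && (b < k) | NOr a b => (a < k) && (b < k) end.
Definition nc_wf (n : nat) (C : nccirc) :=
  [/\ mcirc_wf n (nmono C), 0 < size (ngates C) &
      forall k, k < size (ngates C) ->
        nnode_wf (size (nmono C)) k (nth (NLeaf 0) (ngates C) k)].
Definition nc_size (C : nccirc) : nat :=
  msize (nmono C) + size (ngates C) +
  \sum_(nd <- ngates C) (match nd with NLeaf _ => 0 | NNot _ => 1 | _ => 2 end).

Definition NC2_MONOTONE (L : lang) :=
  exists (C : nat -> nccirc) (c e : nat),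
  forall n, 0 < n ->
    nc_wf n (C n) /\ nc_size (C n) <= c * n ^ e + c /\
    nc_depth (C n) <= c * (trunc_log 2 n) ^ 2 + c /\
    forall b, size b = n -> (L b <-> nc_accepts (C n) b).

(* Main.v *)
Require Import Defs.
From mathcomp Require Import all_boot all_order all_algebra.
From mathcomp Require Import all_fingroup all_field.
From mathcomp Require Import zify boolp.
Set Implicit Arguments. Unset Strict Implicit. Unset Printing Implicit Defensive.
Import GRing.Theory.

(** Above [beta], every threshold of an element in a totally ordered factor (the order being
    reversed if necessary so that [io false <= io true]) is computed along the circuit by
    monotone gates; this yields the [beta]-class of every node.

    Below [beta], let [g] be covered by [d] with type 2, with trace [N]. Unary polynomials
    mapping a [d]-block into [N] separate points modulo [g]. Since polynomials are affine
    on [N] and [d] is generated over [g] by any pair of [N] that is not in [g], the mixed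
    differences of a polynomial mapping a product of [d]-blocks into [N] vanish, so it is a
    sum of unary polynomials. Hence, once all [d]-classes are known, the coordinates in
    [GF(p)] of all nodes modulo [g] are given by a branching program that follows the circuit.

    Finally a branching program over [GF(p)] is evaluated in [NC^2] by repeatedly squaring
    its adjacency matrix. *)

(** An operation is affine in the coordinates only after the [d]-classes of its arguments are fixed:
    both the constant and the coordinates that enter depend on them. The descent therefore takes one
    cover at a time: the classes modulo [d] are first made available as bits, and these bits then
    serve as 0/1 edge labels that select one affine map at each node. What remains is a linear
    recurrence along the circuit, and path sums solve exactly such recurrences. The recurrence
    closes up because the coordinates range over all unary polynomials into [N]: fixing all but one
    argument of an operation and applying such a polynomial gives another one. Chains of covers
    below [beta] have length bounded in terms of [A], so each cover may cost three new layers.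
    Monotone gates supply no constants, so class bits are trusted only on words containing both 0
    and 1; the two constant words of each length are settled by the output layers. *)

(** * Polynomial growth *)

Definition polybound (f : nat -> nat) := exists e, forall N, f N <= N.+2 ^ e.

Lemma polybound_cst c : polybound (fun=> c).
Proof.
exists c => N; apply: leq_trans (ltnW (ltn_expl c (isT : 1 < 2))) _.
by case: c => // c; rewrite leq_exp2r.
Qed.

Lemma polybound_id : polybound id.
Proof. by exists 1 => N; rewrite expn1 ltnW. Qed.

Lemma polybound_add f g : polybound f -> polybound g -> polybound (fun N => f N + g N).
Proof.
move=> [a fa] [b gb]; exists (a + b).+1 => N.
rewrite expnS; apply: (@leq_trans (2 * N.+2 ^ (a + b))); last by rewrite leq_mul2r ltnS orbT.
rewrite mul2n -addnn leq_add //.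
  by apply: leq_trans (fa N) _; rewrite leq_exp2l ?leq_addr.
by apply: leq_trans (gb N) _; rewrite leq_exp2l ?leq_addl.
Qed.

Lemma polybound_mul f g : polybound f -> polybound g -> polybound (fun N => f N * g N).
Proof. by move=> [a fa] [b gb]; exists (a + b) => N; rewrite expnD leq_mul. Qed.

Lemma polybound_exp f k : polybound f -> polybound (fun N => f N ^ k).
Proof.
move=> [a fa]; exists (a * k) => N; rewrite expnM.
by case: k => // k; rewrite leq_exp2r.
Qed.

Lemma polybound_std f : polybound f -> exists c e, forall n, 0 < n -> f n <= c * n ^ e + c.
Proof.
(* The factor [3 ^ e] comes from [n.+2 <= 3 * n] for positive [n]. *)
move=> [e fe]; exists (3 ^ e), e => n n0; apply: leq_trans (fe n) _.
apply: leq_trans (leq_addr _ _); rewrite -expnMn.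
by case: e fe => // e _; rewrite leq_exp2r //; lia.
Qed.

(** * Branching program gates *)

Lemma eq_big_all (R : Type) (idx : R) (op : R -> R -> R) (J : Type) (r : seq J)
    (a P : pred J) (F G : J -> R) :
  all a r -> (forall i, a i -> P i -> F i = G i) ->
  \big[op/idx]_(i <- r | P i) F i = \big[op/idx]_(i <- r | P i) G i.
Proof.
move=> ar FG; elim: r ar => [|x r IH] /=; rewrite ?big_nil // => /andP[ax ar].
by rewrite !big_cons IH //; case: ifP => // Px; rewrite FG.
Qed.

Lemma all_flatten (T : Type) (a : pred T) (ss : seq (seq T)) :
  all a (flatten ss) = all (all a) ss.
Proof. by elim: ss => //= s ss IH; rewrite all_cat IH. Qed.

(** Edges go upward, so the recurrence has only one solution. A gate is then verified by exhibiting
    the intended vertex values. *)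
Lemma abp_vals_uniq p (E : seq (nat * nat * alabel p)) (y : nat -> bool) nv
    (w : nat -> 'F_p) :
  all (fun e => e.1.1 < e.1.2) E -> w 0 = 1%R ->
  (forall k, 0 < k < nv ->
     w k = (\sum_(e <- E | e.1.2 == k) w e.1.1 * alab_val y e.2)%R) ->
  forall k, k <= nv -> abp_vals E y k = mkseq w k.
Proof.
move=> Elt w0 wS; elim=> [//|k IH] lek.
rewrite mkseqS /= IH 1?ltnW //; congr rcons.
case: eqP => [->//|/eqP k0]; rewrite wS ?lt0n ?k0 //.
by apply: (eq_big_all _ _ Elt) => e elt /eqP ek; rewrite nth_mkseq // -ek.
Qed.

Lemma babp_value_uniq p (g : babp p) m (y : nat -> bool) (w : nat -> 'F_p) :
  babp_wf m g -> w 0 = 1%R ->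
  (forall k, 0 < k < bnv g ->
     w k = (\sum_(e <- bedges g | e.1.2 == k) w e.1.1 * alab_val y e.2)%R) ->
  babp_value g y = w (bnv g).-1.
Proof.
move=> /andP[nv0 wfg] w0 wS; rewrite /babp_value.
have -> : abp_vals (bedges g) y (bnv g) = mkseq w (bnv g).
  apply: (abp_vals_uniq (nv := bnv g)) => //.
  by apply: sub_all wfg => e /andP[/andP[]].
by rewrite nth_mkseq // prednK.
Qed.

Definition in_label p (T : finType) (l : T + 'F_p) : alabel p :=
  match l with inl t => AVar p (enum_rank t) | inr c => ACst c end.

(* In [inE], [None] is the source; [rk] certifies acyclicity. *)
Lemma vertex_gate p (T W : finType) (rk : W -> nat)
    (inE : W -> seq (option W * (T + 'F_p))) (v0 : W) (tgt : {set 'F_p}) :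
  (forall v u l, (Some u, l) \in inE v -> rk u < rk v) ->
  exists g : babp p, [/\ babp_wf #|T| g,
    babp_size g <= #|W|.+1 + \sum_v size (inE v), btarget g = tgt &
    forall (Y : nat -> bool) (w : W -> 'F_p),
      (forall v, w v = (\sum_(e <- inE v) oapp w 1 e.1 * alab_val Y (in_label e.2))%R) ->
      babp_value g Y = w v0].
Proof.
(* Sorting by rank yields a topological order. Vertex numbers start at 1 because 0 is the source. *)
move=> rkP; pose srt := sort (relpre rk leq) (enum W).
have srtW v : v \in srt by rewrite mem_sort mem_enum.
have sizes : size srt = #|W| by rewrite size_sort cardE.
pose ix v := (index v srt).+1.
have ixle v : ix v <= #|W| by rewrite /ix -sizes index_mem.
have ix_inj : injective ix.
  move=> u v [] e; rewrite -[u](nth_index u (srtW u)) e (set_nth_default v) ?index_mem //.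
  by rewrite nth_index.
have ix_lt u v : rk u < rk v -> ix u < ix v.
  move=> uv; rewrite ltnS ltnNge; apply/negP => le_vu.
  have trW : transitive (relpre rk leq) by move=> a b c; apply: leq_trans.
  have rfW : reflexive (relpre rk leq) by move=> a /=.
  have stW : sorted (relpre rk leq) srt by apply: sort_sorted => a b; apply: leq_total.
  by have := sorted_leq_index trW rfW stW v u (srtW v) (srtW u) le_vu; rewrite /= leqNgt uv.
(* The program is cut just after [v0], which becomes the sink; since edges go upward, later vertices
   do not influence its value. *)
pose nv := (ix v0).+1.
pose ed v := [seq (oapp ix 0 e.1, ix v, in_label e.2) | e <- inE v].
pose E := flatten [seq ed v | v <- enum W & ix v < nv].
have gwf : babp_wf #|T| (Babp nv E tgt).
  apply/andP; split=> //=; rewrite all_flatten all_map; apply/allP => v.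
  rewrite mem_filter => /andP[vlt _] /=; rewrite all_map; apply/allP => -[o l] ol /=.
  rewrite vlt andbT; apply/andP; split.
    by case: o ol => [u|] /= ol; rewrite ?ix_lt ?(rkP _ _ _ ol).
  by case: l ol => [t|c] //= _; rewrite ltn_ord.
exists (Babp nv E tgt); split=> //.
- rewrite /babp_size /= /nv; apply: leq_add; first by rewrite ltnS.
  rewrite size_flatten /shape -map_comp sumnE big_map big_filter big_enum_cond /=.
  rewrite [X in _ <= X](bigID (fun v => ix v < nv)) /=.
  by apply: leq_trans (leq_addr _ _); apply: leq_sum => v _; rewrite size_map.
- move=> Y w wE.
  pose w' (k : nat) : 'F_p := if k is k'.+1 then w (nth v0 srt k') else 1%R.
  have w'ix v : w' (ix v) = w v by rewrite /= nth_index.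
  have w'o o : w' (oapp ix 0 o) = oapp w 1%R o by case: o => //= a; exact: w'ix.
  rewrite (babp_value_uniq gwf (w := w')) //=.
    by rewrite nth_index.
  move=> k /andP[k0 knv].
  have [v kv] : exists v, k = ix v.
    case: k k0 knv => // k _ klt; exists (nth v0 srt k).
    by rewrite /ix index_uniq ?sort_uniq ?enum_uniq // sizes (leq_trans _ (ixle v0)).
  rewrite kv w'ix wE /E big_flatten big_map big_filter big_enum_cond /=.
  rewrite (bigD1 v) /=; last by rewrite -kv.
  rewrite [X in (_ + X)%R]big1 ?addr0 => [|u /andP[_ uv]].
    rewrite big_map; apply: eq_big => [e|e _] /=; first by rewrite eqxx.
    by rewrite w'o.
  rewrite big_map big_pred0 // => e /=.
  by apply/negbTE; apply: contra uv => /eqP/ix_inj->.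
Qed.

(** The program is a path with one edge per literal; the product of the first [k] labels is the
    conjunction of the first [k] literals. *)
Lemma and_gate p (T : finType) (l : seq T) : prime p ->
  exists g : babp p, [/\ babp_wf #|T| g, babp_size g <= (size l).*2.+1 &
    forall Y, babp_eval Y g = all (fun t => Y (enum_rank t)) l].
Proof.
move=> pp; case: l => [|t0 l].
  exists (@Babp p 1 [::] setT); split=> // Y.
  by rewrite /babp_eval inE.
move: {l}(t0 :: l) => s; pose lab i : alabel p := AVar p (enum_rank (nth t0 s i)).
pose g := @Babp p (size s).+1 [seq (i, i.+1, lab i) | i <- iota 0 (size s)] [set 1%R].
have gwf : babp_wf #|T| g.
  rewrite /babp_wf /= all_map; apply/allP => i; rewrite mem_iota add0n => /= il.
  by rewrite ltnSn ltnS il /= ltn_ord.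
exists g; split=> // [|Y].
  by rewrite /babp_size size_map size_iota -addnn /= leqnn.
rewrite /babp_eval (babp_value_uniq (w := fun k =>
  ((all (fun t => Y (enum_rank t)) (take k s) : nat)%:R)%R) gwf) //=.
  by rewrite take_size inE; case: (all _ _); rewrite ?eqxx // eq_sym oner_eq0.
  by rewrite take0.
case=> // k klt; rewrite big_map -big_filter.
rewrite (eq_filter (a2 := pred1 k)) => [|i /=]; last by rewrite eqSS.
rewrite filter_pred1_uniq ?iota_uniq ?mem_iota //= big_seq1 /=.
rewrite -natrM mulnb (take_nth t0) // all_rcons; congr (_ %:R)%R; by rewrite andbC.
Qed.

(** Parallel edges join source and sink. With one edge and a suitable target the gate copies or
    negates a bit; with several it counts modulo [p]. *)
Lemma sum_gate p (T : finType) (l : seq T) (tgt : {set 'F_p}) :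
  exists g : babp p, [/\ babp_wf #|T| g, babp_size g = (size l).+2 &
    forall Y, babp_eval Y g = ((\sum_(t <- l) Y (enum_rank t))%:R%R \in tgt)].
Proof.
exists (@Babp p 2 [seq (0, 1, AVar p (enum_rank t)) | t <- l] tgt); split.
- rewrite /babp_wf all_map /=; by elim: l => //= t l ->; rewrite ltn_ord.
- by rewrite /babp_size size_map.
move=> Y; rewrite /babp_eval /babp_value /= big_map natr_sum.
by under eq_bigr do rewrite mul1r.
Qed.

(** * Iterated layers *)

(* [Spec x y]: [y] is an admissible vector of bits indexed by [T] on input [x];
   the top layer of the circuit lists its bits in the order of [enum T]. *)
Definition layers_realize n (ps : seq nat) (T : finType)
    (Spec : (nat -> bool) -> (T -> bool) -> Prop) (s : nat) :=
  exists C : itcirc ps,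
    [/\ mcirc_wf n (imono C) /\ 0 < size ps, size (ilayers C 0) = #|T|,
        forall k, k < size ps ->
          all (babp_wf (if k.+1 < size ps then size (ilayers C k.+1)
                        else size (imono C))) (ilayers C k),
        it_size C <= s &
        forall x, Spec x (fun t => nth false (it_vals C x (size ps)) (enum_rank t))].

(** Layers are numbered from the top, so a new top layer shifts the numbers of all others. *)
Definition it_push ps (C : itcirc ps) p (gs : seq (babp p)) : itcirc (p :: ps) :=
  @ItCirc (p :: ps) (imono C)
    (fun k => match k return seq (babp (nth 2 (p :: ps) k)) with
              | 0 => gs | k'.+1 => ilayers C k' end).

Lemma it_vals_push ps (C : itcirc ps) p (gs : seq (babp p)) x m :
  m <= size ps -> it_vals (it_push C gs) x m = it_vals C x m.
Proof.
elim: m => // m IH lem; rewrite [LHS]/= [RHS]/= IH 1?ltnW //.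
rewrite -/(size ps) subSS; have -> : size ps - m = (size ps - m.+1).+1 by lia.
by [].
Qed.

Lemma it_size_push ps (C : itcirc ps) p (gs : seq (babp p)) :
  it_size (it_push C gs) = it_size C + \sum_(g <- gs) babp_size g.
Proof. by rewrite /it_size /= big_ord_recl /=; rewrite addnCA [RHS]addnC. Qed.

Lemma nth_enum_rank (T : finType) R (x0 : R) (f : T -> R) t :
  nth x0 [seq f u | u <- enum T] (enum_rank t) = f t.
Proof. by rewrite (nth_map t) ?nth_enum_rank // -cardE ltn_ord. Qed.

Lemma layers_push n ps (T T' : finType) Spec Spec' s p q (G : T' -> babp p) :
  @layers_realize n ps T Spec s ->
  (forall t', babp_wf #|T| (G t') /\ babp_size (G t') <= q) ->
  (forall (x Y : nat -> bool), Spec x (fun t => Y (enum_rank t)) ->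
     Spec' x (fun t' => babp_eval Y (G t'))) ->
  @layers_realize n (p :: ps) T' Spec' (s + #|T'| * q).
Proof.
move=> [C [[Cm ps0] C0 Cwf Cs CS]] GP SS.
exists (it_push C [seq G t' | t' <- enum T']); split=> //.
- by rewrite size_map -cardE.
- case=> [|k] klt; last exact: Cwf.
  by rewrite /= ltnS ps0 C0 all_map; apply/allP => t' _ /=; case: (GP t').
- rewrite it_size_push leq_add // big_map big_enum /= -sum_nat_const.
  by apply: leq_sum => t' _; case: (GP t').
move=> x; have /SS := CS x.
rewrite -(it_vals_push C [seq G t' | t' <- enum T'] x (leqnn _)).
set ys := it_vals _ _ _ => H.
rewrite (_ : (fun t => _) = (fun t' => babp_eval (fun j => nth false ys j) (G t'))) //.
apply: funext => t'; rewrite [it_vals _ _ _]/= -/ys subnn -map_comp.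
exact: nth_enum_rank.
Qed.

(** * Monotone circuits *)

Inductive mform := MLeaf of nat | MFAnd of mform & mform | MFOr of mform & mform.
Fixpoint mfeval (v : nat -> bool) f := match f with
  | MLeaf i => v i | MFAnd f g => mfeval v f && mfeval v g
  | MFOr f g => mfeval v f || mfeval v g end.
Fixpoint mfsize f := match f with
  | MLeaf _ => 0 | MFAnd f g | MFOr f g => (mfsize f + mfsize g).+1 end.
Fixpoint mfbound k f := match f with
  | MLeaf i => i < k | MFAnd f g | MFOr f g => mfbound k f && mfbound k g end.

(** Formulas have no constants; the leaf [o] stands in for the neutral element at the end of the
    list. *)
Definition mbigand o l := foldr MFAnd (MLeaf o) l.
Definition mbigor o l := foldr MFOr (MLeaf o) l.

Lemma mfeval_bigand v o l : mfeval v (mbigand o l) = all (mfeval v) l && v o.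
Proof. by elim: l => //= f l ->; rewrite andbA. Qed.
Lemma mfeval_bigor v o l : mfeval v (mbigor o l) = has (mfeval v) l || v o.
Proof. by elim: l => //= f l ->; rewrite orbA. Qed.
Lemma mfsize_bigand o l : mfsize (mbigand o l) = \sum_(f <- l) (mfsize f).+1.
Proof. by elim: l => [|f l /= ->]; rewrite ?big_nil ?big_cons. Qed.
Lemma mfsize_bigor o l : mfsize (mbigor o l) = \sum_(f <- l) (mfsize f).+1.
Proof. by elim: l => [|f l /= ->]; rewrite ?big_nil ?big_cons. Qed.
Lemma mfbound_bigand k o l : mfbound k (mbigand o l) = all (mfbound k) l && (o < k).
Proof. by elim: l => //= f l ->; rewrite andbA. Qed.
Lemma mfbound_bigor k o l : mfbound k (mbigor o l) = all (mfbound k) l && (o < k).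
Proof. by elim: l => //= f l ->; rewrite andbA. Qed.

Lemma mfbound_leq k k' f : k <= k' -> mfbound k f -> mfbound k' f.
Proof.
move=> kk'; elim: f => [i|f IHf g IHg|f IHf g IHg] /=; first by move/leq_trans; apply.
  by case/andP=> /IHf-> /IHg->.
by case/andP=> /IHf-> /IHg->.
Qed.

Lemma eq_mfeval k v v' f : mfbound k f -> (forall i, i < k -> v i = v' i) ->
  mfeval v f = mfeval v' f.
Proof.
move=> + vv; elim: f => [i /vv//|f IHf g IHg|f IHf g IHg] /= /andP[/IHf-> /IHg->] //.
Qed.

Lemma mvals_rcons x c nd :
  mvals x (rcons c nd) = rcons (mvals x c) (mnode_val x (mvals x c) nd).
Proof. by rewrite /mvals -cats1 foldl_cat. Qed.

Lemma size_mvals x c : size (mvals x c) = size c.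
Proof. by elim/last_ind: c => // c nd IH; rewrite mvals_rcons !size_rcons IH. Qed.

Lemma nth_mvals_cat x c d i : i < size c ->
  nth false (mvals x (c ++ d)) i = nth false (mvals x c) i.
Proof.
move=> ic; elim/last_ind: d => [|d nd IH]; first by rewrite cats0.
by rewrite -rcons_cat mvals_rcons nth_rcons size_mvals size_cat ltn_addr.
Qed.

Lemma nth_mvals_last x c nd :
  nth false (mvals x (rcons c nd)) (size c) = mnode_val x (mvals x c) nd.
Proof. by rewrite mvals_rcons nth_rcons size_mvals ltnn eqxx. Qed.

Lemma mcirc_wf_rcons n c nd :
  mcirc_wf n c -> mnode_wf n (size c) nd -> mcirc_wf n (rcons c nd).
Proof.
move=> wfc wfd k; rewrite size_rcons ltnS nth_rcons => kc.
by case: ltngtP kc => // [kc _|->//]; apply: wfc.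
Qed.

Lemma msize_leq c : msize c <= 3 * size c.
Proof.
rewrite /msize [3 * _](_ : _ = size c + 2 * size c); last by lia.
rewrite leq_add2l mulnC -sum1_size big_distrl /=.
by apply: leq_sum => -[].
Qed.

Lemma mono_formula n c f : mcirc_wf n c -> mfbound (size c) f ->
  exists d p, [/\ mcirc_wf n (c ++ d), size d <= mfsize f, p < size (c ++ d) &
    forall x, nth false (mvals x (c ++ d)) p = mfeval (nth false (mvals x c)) f].
Proof.
(* The circuit [c] is generalized because the second operand is compiled on top of the nodes already
   added for the first. *)
pose P (f : mform) := forall c, mcirc_wf n c -> mfbound (size c) f ->
  exists d p, [/\ mcirc_wf n (c ++ d), size d <= mfsize f, p < size (c ++ d) &
    forall x, nth false (mvals x (c ++ d)) p = mfeval (nth false (mvals x c)) f].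
have bin (nd : nat -> nat -> mnode) (op : bool -> bool -> bool) f1 f2 :
    (forall k a b, a < k -> b < k -> mnode_wf n k (nd a b)) ->
    (forall x vs a b, mnode_val x vs (nd a b) = op (nth false vs a) (nth false vs b)) ->
    P f1 -> P f2 -> forall c, mcirc_wf n c -> mfbound (size c) f1 -> mfbound (size c) f2 ->
    exists d p, [/\ mcirc_wf n (c ++ d), size d <= (mfsize f1 + mfsize f2).+1,
      p < size (c ++ d) &
    forall x, nth false (mvals x (c ++ d)) p =
      op (mfeval (nth false (mvals x c)) f1) (mfeval (nth false (mvals x c)) f2)].
  move=> ndwf ndval IH1 IH2 {}c wfc b1 b2.
  have [d1 [p1 [wf1 s1 lt1 v1]]] := IH1 c wfc b1.
  have b2' : mfbound (size (c ++ d1)) f2.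
    by apply: mfbound_leq b2; rewrite size_cat leq_addr.
  have [d2 [p2 [wf2 s2 lt2 v2]]] := IH2 _ wf1 b2'.
  have lt1' : p1 < size ((c ++ d1) ++ d2) by rewrite size_cat ltn_addr.
  exists (d1 ++ rcons d2 (nd p1 p2)), (size ((c ++ d1) ++ d2)).
  rewrite catA -rcons_cat; split.
  - by apply: mcirc_wf_rcons => //; apply: ndwf.
  - by rewrite size_cat size_rcons addnS ltnS leq_add.
  - by rewrite size_rcons.
  move=> x; rewrite nth_mvals_last ndval nth_mvals_cat // v1 v2; congr (op _ _).
  by apply: eq_mfeval b2 _ => i ic; rewrite nth_mvals_cat.
rewrite -/(P f); move: c; elim: f => [i|f IHf g IHg|f IHf g IHg] c wfc.
- by move=> ic; exists [::], i; rewrite cats0; split.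
- by case/andP; apply: (bin MAnd andb) => // k a b /= -> ->.
- by case/andP; apply: (bin MOr orb) => // k a b /= -> ->.
Qed.

Lemma mono_formulas n (T : finType) c (F : T -> mform) : mcirc_wf n c ->
  (forall t, mfbound (size c) (F t)) ->
  exists d pos, [/\ mcirc_wf n (c ++ d), size d <= \sum_t mfsize (F t),
    forall t, pos t < size (c ++ d) &
    forall x t, nth false (mvals x (c ++ d)) (pos t) = mfeval (nth false (mvals x c)) (F t)].
Proof.
move=> wfc Fb.
have [d [pos [dwf ds dp dv]]] : exists d pos, [/\ mcirc_wf n (c ++ d),
    size d <= \sum_(t <- enum T) mfsize (F t),
    forall t, t \in enum T -> pos t < size (c ++ d) &
    forall x t, t \in enum T ->
      nth false (mvals x (c ++ d)) (pos t) = mfeval (nth false (mvals x c)) (F t)].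
  elim: (enum T) => [|t s [d [pos [dwf ds dp dv]]]].
    by exists [::], (fun=> 0); rewrite cats0 big_nil; split.
  have b' : mfbound (size (c ++ d)) (F t).
    by apply: mfbound_leq (Fb t); rewrite size_cat leq_addr.
  have [d' [p [wf' s' lt' v']]] := mono_formula dwf b'.
  exists (d ++ d'), (fun u => if u == t then p else pos u); rewrite catA; split=> //.
  - by rewrite big_cons size_cat addnC leq_add.
  - move=> u; rewrite inE; case: eqP => //= _ us.
    by rewrite size_cat ltn_addr // dp.
  move=> x u; rewrite inE; case: eqP => [->|_] /= us.
    by rewrite v'; apply: eq_mfeval (Fb t) _ => i ic; rewrite nth_mvals_cat.
  by rewrite nth_mvals_cat ?dp // dv.
exists d, pos; split=> // [|t|x t]; rewrite ?big_enum // in ds *.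
  by apply: dp; rewrite mem_enum.
by apply: dv; rewrite mem_enum.
Qed.

(* Monotone gates cannot produce constants: the constants 1 and 0 are replaced by
   the disjunction and the conjunction of the inputs, which is right on inputs
   satisfying [mixed_input]. *)
Definition mixed_input n (x : nat -> bool) :=
  (exists2 j, j < n & x j) /\ (exists2 j, j < n & ~~ x j).

Lemma mono_inputs n : 0 < n ->
  exists c one zero, [/\ mcirc_wf n c, n <= size c, size c <= 3 * n,
    one < size c /\ zero < size c &
    forall x, (forall j, j < n -> nth false (mvals x c) j = x j) /\
      (mixed_input n x -> nth false (mvals x c) one = true
                          /\ nth false (mvals x c) zero = false)].
Proof.
move=> n0.
have [c0 [wf0 s0 v0]] : exists c0, [/\ mcirc_wf n c0, size c0 = n &
    forall x j, j < n -> nth false (mvals x c0) j = x j].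
  have : n <= n by [].
  elim: {1 4 5}n => [_|k IH klt]; first by exists [::]; split.
  have [c [cwf cs cv]] := IH (ltnW klt).
  exists (rcons c (MIn k)); split; [exact: mcirc_wf_rcons|by rewrite size_rcons cs|].
  move=> x j; rewrite ltnS leq_eqVlt => /orP[/eqP->|jk].
    by rewrite -cs nth_mvals_last.
  by rewrite -cats1 nth_mvals_cat ?cs // cv.
pose fl := [seq MLeaf j | j <- iota 0 n].
(* The closing leaf 0 repeats the first input, already a member of [fl], so it does not change the
   value. *)
pose F b := if b then mbigor 0 fl else mbigand 0 fl.
have Fb b : mfbound (size c0) (F b).
  have fb : all (mfbound n) fl.
    by rewrite all_map; apply/allP => j; rewrite mem_iota add0n.
  by rewrite s0; case: b; rewrite ?mfbound_bigor ?mfbound_bigand fb n0.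
have Fs b : mfsize (F b) = n.
  by case: b; rewrite /F ?mfsize_bigor ?mfsize_bigand big_map /= sum1_size size_iota.
have [d [pos [dwf ds dp dv]]] := mono_formulas wf0 Fb.
exists (c0 ++ d), (pos true), (pos false); split=> //.
- by rewrite size_cat s0 leq_addr.
- rewrite size_cat s0; move: ds; rewrite big_bool !Fs /= => H; lia.
move=> x; split=> [j jn|[[j1 j1n xj1] [j2 j2n xj2]]].
  by rewrite nth_mvals_cat ?s0 // v0.
rewrite !dv mfeval_bigor mfeval_bigand; split.
  apply/orP; left; rewrite has_map; apply/hasP; exists j1; first by rewrite mem_iota.
  by rewrite /= v0.
apply/negbTE; rewrite negb_and; apply/orP; left; rewrite all_map.
by apply/allPn; exists j2; rewrite ?mem_iota //= v0.
Qed.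

(** * Values of circuits *)

Section Values.
Variables (I : finType) (ar : I -> nat) (A : finAlg ar).

Definition node_value (io : bool -> fcar A) (c : seq (cnode A)) (x : nat -> bool) k :=
  nth (io false) (cvals (io false) (fun j => io (x j)) c) k.

Lemma cvals_rcons d x (c : seq (cnode A)) nd :
  cvals d x (rcons c nd) = rcons (cvals d x c) (cnode_val d x (cvals d x c) nd).
Proof. by rewrite /cvals -cats1 foldl_cat. Qed.

Lemma size_cvals d x (c : seq (cnode A)) : size (cvals d x c) = size c.
Proof. by elim/last_ind: c => // c nd IH; rewrite cvals_rcons !size_rcons IH. Qed.

Lemma node_valueE n io (c : seq (cnode A)) x k :
  (forall k, k < size c -> cnode_wf n k (nth (CVar A 0) c k)) -> k < size c ->
  node_value io c x k = match nth (CVar A 0) c k with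
    | CVar j => io (x j) | CConst a => a
    | COp i args => @fops _ _ A i (fun q => node_value io c x (args q)) end.
Proof.
rewrite /node_value; elim/last_ind: c => // c nd IH wf.
have wf' j : j < size c -> cnode_wf n j (nth (CVar A 0) c j).
  by move=> jc; have := wf j; rewrite size_rcons nth_rcons jc; apply; apply: ltnW.
have stab j : j < size c ->
    nth (io false) (cvals (io false) (fun j => io (x j)) (rcons c nd)) j =
    nth (io false) (cvals (io false) (fun j => io (x j)) c) j.
  by move=> jc; rewrite cvals_rcons nth_rcons size_cvals jc.
rewrite size_rcons ltnS leq_eqVlt => /orP[/eqP->|kc].
  rewrite {1}cvals_rcons !nth_rcons size_cvals ltnn eqxx.
  have := wf (size c); rewrite size_rcons nth_rcons ltnn eqxx => /(_ (ltnSn _)).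
  case: nd stab {wf} => //= i args stab /forallP argP.
  by congr (fops _); apply: funext => q; rewrite stab.
rewrite stab // IH // nth_rcons kc; have := wf' k kc.
case: nth => //= i args /forallP argP.
congr (fops _); apply: funext => q; rewrite stab //; exact: ltn_trans kc.
Qed.

Lemma cout_node_value io (c : seq (cnode A)) x : 0 < size c ->
  cout (io false) (fun j => io (x j)) c = node_value io c x (size c).-1.
Proof. by move=> c0; rewrite /cout /node_value -(size_cvals (io false) (fun j => io (x j)) c) nth_last. Qed.

Variables (J : finType) (le : J -> rel (fcar A)) (io : bool -> fcar A).
Hypothesis le_refl : forall j, reflexive (le j).
Hypothesis le_trans : forall j, transitive (le j).
Hypothesis le_op : forall j i (x y : 'I_(ar i) -> fcar A),
  (forall k, le j (x k) (y k)) -> le j (@fops _ _ A i x) (@fops _ _ A i y).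
Hypothesis le_io : forall j, le j (io false) (io true).

Definition threshold_gates := \sum_i #|{ffun 'I_(ar i) -> fcar A}| * (ar i).+1.

(** By monotonicity, a threshold lies below the value of an operation iff it lies below the
    operation at some tuple [w] that is componentwise below the arguments; for one direction [w] is
    the tuple of arguments itself. This is a disjunction over [w] of conjunctions of earlier
    thresholds. By [le_io], a threshold of an input node is constantly true, the input bit itself,
    or constantly false. *)
Lemma mono_thresholds n (c : seq (cnode A)) : 0 < n ->
  (forall k, k < size c -> cnode_wf n k (nth (CVar A 0) c k)) ->
  exists mc pos, [/\ mcirc_wf n mc,
    n <= size mc /\ size mc <= 3 * n + size c * (#|{: J * fcar A}| * threshold_gates),
    forall m q, m < size c -> pos m q < size mc &
    forall x, (forall j, j < n -> nth false (mvals x mc) j = x j) /\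
      (mixed_input n x -> forall m q, m < size c ->
         nth false (mvals x mc) (pos m q) = le q.1 q.2 (node_value io c x m))].
Proof.
move=> n0 wfc.
have [c0 [one [zero [wf0 ns0 s0 [one0 zero0] v0]]]] := mono_inputs n0.
pose R s (pos : nat -> J * fcar A -> nat) (mc : seq mnode) :=
  [/\ mcirc_wf n mc,
    n <= size mc /\ size mc <= 3 * n + s * (#|{: J * fcar A}| * threshold_gates),
    one < size mc /\ zero < size mc,
    forall m q, m < s -> pos m q < size mc &
    forall x, (forall j, j < n -> nth false (mvals x mc) j = x j) /\
      (mixed_input n x -> [/\ nth false (mvals x mc) one = true,
         nth false (mvals x mc) zero = false &
         forall m q, m < s ->
         nth false (mvals x mc) (pos m q) = le q.1 q.2 (node_value io c x m)])].
suff [mc [pos [wf s _ p v]]] : exists mc pos, R (size c) pos mc.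
  exists mc, pos; split=> // x; have [vi vm] := v x; split=> // /vm[] //.
have : size c <= size c by [].
elim: {1 3}(size c) => [_|k IH kc].
  exists c0, (fun _ _ => 0); split=> //; first by rewrite mul0n addn0.
  by move=> x; have [vi vm] := v0 x; split=> // /vm[].
have [mc [pos [wf [ns s] [one1 zero1] p v]]] := IH (ltnW kc).
pose cst (b : bool) := MLeaf (if b then one else zero).
pose F (q : J * fcar A) := match nth (CVar A 0) c k with
  | CVar j => if le q.1 q.2 (io false) then cst true
              else if le q.1 q.2 (io true) then MLeaf j else cst false
  | CConst a => cst (le q.1 q.2 a)
  | COp i args => mbigor zero
      [seq mbigand one [seq MLeaf (pos (args k) (q.1, w k)) | k <- enum 'I_(ar i)]
      | w : {ffun 'I_(ar i) -> fcar A} <- enum {: {ffun 'I_(ar i) -> fcar A}} & le q.1 q.2 (@fops _ _ A i w)]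
  end.
have cstb b : mfbound (size mc) (cst b) by case: b.
have wfk := wfc k kc.
have Fb q : mfbound (size mc) (F q).
  rewrite /F; case: nth wfk => [j jn|a _|i args /forallP argP] //=.
  - by do 2?[case: ifP => _] => //=; exact: leq_trans ns.
  - exact: cstb.
  rewrite mfbound_bigor zero1 andbT all_map; apply/allP => w _ /=.
  rewrite mfbound_bigand one1 andbT all_map; apply/allP => r _ /=.
  exact: p.
have Fs q : mfsize (F q) <= threshold_gates.
  rewrite /F; case: nth wfk => [j jn|a _|i args /forallP argP] //=.
    by do 2?[case: ifP => _].
  rewrite mfsize_bigor big_map big_filter /threshold_gates (bigD1 i) //=.
  apply: leq_trans (leq_addr _ _); rewrite big_mkcond /= big_enum /= -sum_nat_const.
  apply: leq_sum => w _; case: ifP => // _.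
  by rewrite mfsize_bigand big_map /= sum1_size -cardE card_ord.
have [d [npos [dwf ds dp dv]]] := mono_formulas wf Fb.
exists (mc ++ d), (fun m => if m == k then npos else pos m); split=> //.
- rewrite size_cat; split; first by rewrite (leq_trans ns) ?leq_addr.
  rewrite mulSn addnCA [X in _ <= X]addnC leq_add //.
  apply: leq_trans ds _; rewrite -sum_nat_const; exact: leq_sum.
- by rewrite size_cat !ltn_addr.
- move=> m q; rewrite ltnS leq_eqVlt; case: eqP => //= _ mk.
  by rewrite size_cat ltn_addr // p.
move=> x; have [vi vm] := v x; split=> [j jn|ok].
  by rewrite nth_mvals_cat ?vi // (leq_trans jn).
have [v1 vz vk] := vm ok; split; rewrite ?nth_mvals_cat //.
move=> m q; rewrite ltnS leq_eqVlt; case: (eqVneq m k) => [->|_] /= mk; last first.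
  by rewrite nth_mvals_cat ?p // vk.
rewrite dv /F (node_valueE _ _ wfc kc).
have cstv b : mfeval (nth false (mvals x mc)) (cst b) = b by case: b => /=.
case: nth wfk => [j jn|a _|i args /forallP argP] //=.
- case: ifP => [l0|l0]; last case: ifP => [l1|l1]; rewrite ?cstv /=.
  + by case: (x j) => //; rewrite (le_trans l0).
  + by rewrite vi //; case: (x j).
  + by case: (x j).
- exact: cstv.
rewrite mfeval_bigor vz orbF has_map; apply/hasP/idP => [[w]|leq].
  rewrite mem_filter => /andP[lew _] /=; rewrite mfeval_bigand v1 andbT all_map => /allP H.
  apply: le_trans lew _; apply: le_op => r.
  have := H r (mem_enum _ _); rewrite /= vk //; exact: ltn_trans (argP r) kc || exact: argP.
exists [ffun r => node_value io c x (args r)].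
  rewrite mem_filter mem_enum andbT; apply: le_trans leq _; apply: le_op => r.
  by rewrite ffunE; apply: le_refl.
rewrite /= mfeval_bigand v1 andbT all_map; apply/allP => r _ /=.
by rewrite vk ?ffunE /=; [apply: le_refl|apply: argP].
Qed.

End Values.

(** * Polynomials of a finite algebra *)

Section Update.
Variables (K : nat) (T : Type).
Implicit Types (v x y o : 'I_K -> T).

Definition upd v (k : 'I_K) a : 'I_K -> T := fun j => if j == k then a else v j.
Definition mix x y (m : nat) : 'I_K -> T := fun k => if k < m then y k else x k.

Lemma mix0 x y : mix x y 0 = x.
Proof. by apply: funext. Qed.
Lemma mix_full x y : mix x y K = y.
Proof. by apply: funext => k; rewrite /mix ltn_ord. Qed.
Lemma mix_upd x y (m : 'I_K) : mix x y m = upd (mix x y m) m (x m).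
Proof. by apply: funext => k; rewrite /upd; case: eqP => // ->; rewrite /mix ltnn. Qed.
Lemma mixS_upd x y (m : 'I_K) : mix x y m.+1 = upd (mix x y m) m (y m).
Proof.
apply: funext => k; rewrite /upd /mix; case: eqP => [->|/eqP km]; first by rewrite ltnSn.
by rewrite ltnS leq_eqVlt; move: km; rewrite -val_eqE => /negbTE->.
Qed.
Lemma upd_upd v k a b : upd (upd v k a) k b = upd v k b.
Proof. by apply: funext => j; rewrite /upd; case: eqP. Qed.

(** A hybrid argument: [mix] leads from [x] to [y] by changing one coordinate at a time. *)
Lemma mix_ind (P : ('I_K -> T) -> ('I_K -> T) -> Prop) x y :
  (forall v, P v v) -> (forall u v w, P u v -> P v w -> P u w) ->
  (forall m : 'I_K, P (mix x y m) (mix x y m.+1)) -> P x y.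
Proof.
move=> Pr Pt Ps; suff : forall m, m <= K -> P x (mix x y m).
  by move/(_ K (leqnn _)); rewrite mix_full.
elim=> [_|m IH mK]; first by rewrite mix0.
apply: Pt (IH (ltnW mK)) _; exact: (Ps (Ordinal mK)).
Qed.

(** Vanishing mixed differences make the increment in one coordinate independent of the others; the
    sum telescopes along the hybrids from [o] to [v]. *)
Lemma additive_decomposition (V : zmodType) (B : 'I_K -> pred T) (h : ('I_K -> T) -> V) o :
  (forall k, B k (o k)) ->
  (forall v i j (x x' y y' : T), i != j -> (forall k, B k (v k)) ->
     B i x -> B i x' -> B j y -> B j y' ->
     h (upd (upd v i x) j y) - h (upd (upd v i x) j y') =
     h (upd (upd v i x') j y) - h (upd (upd v i x') j y'))%R ->
  forall v, (forall k, B k (v k)) ->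
  (h v = h o + \sum_k (h (upd o k (v k)) - h o))%R.
Proof.
move=> oB mixed v vB.
have mixB w w' m : (forall k, B k (w k)) -> (forall k, B k (w' k)) ->
    forall k, B k (mix w w' m k) by move=> wB w'B k; rewrite /mix; case: ifP.
have diffC w m : (forall k, B k (w k)) ->
    (h (upd w m (v m)) - h (upd w m (o m)) = h (upd o m (v m)) - h (upd o m (o m)))%R.
  move=> wB; pose P w w' := (h (upd w m (v m)) - h (upd w m (o m))
                             = h (upd w' m (v m)) - h (upd w' m (o m)))%R.
  apply: (@mix_ind P w o) => // [u1 u2 u3|j]; rewrite /P; first by move=> -> ->.
  rewrite mixS_upd {1 2}mix_upd; have [->|jm] := eqVneq j m; first by rewrite !upd_upd.
  by apply: mixed => //; apply: mixB.
have updo k : upd o k (o k) = o by apply: funext => j; rewrite /upd; case: eqP => // ->.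
rewrite -[LHS](subrK (h o)) addrC; congr (_ + _)%R.
have -> : (h v - h o = h (mix o v K) - h (mix o v 0))%R by rewrite mix_full mix0.
rewrite -(telescope_sumr (fun m => h (mix o v m)) (leq0n K)) big_mkord.
apply: eq_bigr => k _; rewrite mixS_upd {2}mix_upd.
by rewrite diffC ?updo //; apply: mixB.
Qed.
End Update.

Section Polynomials.
Variables (I : finType) (ar : I -> nat) (A : finAlg ar).
Notation car := (fcar A).
Notation pol := (pterm ar (fcar A)).
Notation "'ev' v t" := (pteval (@fops _ _ A) v t) (at level 10, v at level 9, t at level 9).

Fixpoint psubst (t : pol) (s : nat -> pol) : pol := match t with
  | PVar j => s j | PCst c => PCst ar c | POp i ts => POp (fun k => psubst (ts k) s) end.

Lemma pteval_psubst v t s : ev v (psubst t s) = ev (fun j => ev v (s j)) t.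
Proof. by elim: t => //= i ts IH; congr fops; apply: funext. Qed.

Lemma con_pteval (r : rel car) t v v' : is_con A r -> (forall j, r (v j) (v' j)) ->
  r (ev v t) (ev v' t).
Proof. by move=> [rr _ _ ro] vv; elim: t => //= i ts IH; apply: ro. Qed.

Definition unary_pol (u : car -> car) := exists t, forall x, u x = upol t x.

Lemma unary_pol_id : unary_pol id.
Proof. by exists (PVar ar car 0). Qed.

Lemma unary_pol_comp u v : unary_pol u -> unary_pol v -> unary_pol (u \o v).
Proof.
move=> [t tu] [s sv]; exists (psubst t (fun=> s)) => x.
by rewrite /upol pteval_psubst /= tu sv.
Qed.

Lemma unary_pol_upd i (o : 'I_(ar i) -> car) k :
  unary_pol (fun x => @fops _ _ A i (upd o k x)).
Proof.
exists (POp (fun j => if j == k then PVar ar car 0 else PCst ar (o j))) => x.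
by rewrite /upol /=; congr fops; apply: funext => j; rewrite /upd; case: eqP.
Qed.

Lemma con_unary_pol (r : rel car) u x y : is_con A r -> unary_pol u -> r x y -> r (u x) (u y).
Proof. by move=> rc [t tu] rxy; rewrite !tu; apply: con_pteval. Qed.

(** Changing one argument of an operation is applying a unary polynomial, and transitivity joins
    these changes. *)
Lemma is_con_unary_pol (r : rel car) : reflexive r -> symmetric r -> transitive r ->
  (forall u x y, unary_pol u -> r x y -> r (u x) (u y)) -> is_con A r.
Proof.
move=> rr rs rt ru; split=> // i x y rxy.
apply: (@mix_ind _ _ (fun v w => r (fops v) (fops w)) x y) => // [u v w|m].
  exact: rt.
rewrite mixS_upd {1}mix_upd.
exact: (ru _ _ _ (unary_pol_upd (mix x y m) m)).
Qed.

(** * Prime quotients and minimal sets *)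

Section Prime.
Variables (a b : rel car).
Hypothesis ab : prime_quot A a b.

(** [R] is a congruence between [a] and [b] and different from [a]. This is how a property of a
    single pair outside [a], typically taken in the trace, spreads to all pairs of [b]. *)
Lemma prime_absorb (R : car -> car -> Prop) :
  (forall x, R x x) -> (forall x y, R x y -> R y x) ->
  (forall x y z, R x y -> R y z -> R x z) ->
  (forall u x y, unary_pol u -> R x y -> R (u x) (u y)) ->
  (forall x y, a x y -> R x y) -> (forall x y, R x y -> b x y) ->
  (exists x y, R x y /\ ~~ a x y) -> forall x y, b x y -> R x y.
Proof.
move=> Rr Rs Rt Ru aR Rb [x0 [y0 [R0 a0]]] x y bxy.
case: ab => _ _ _ _ /(_ (fun x y => `[<R x y>])) [].
- apply: is_con_unary_pol => [z|z w|z w t|u z w uu].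
  + exact/asboolP.
  + by apply/asboolP/asboolP; apply: Rs.
  + by move=> /asboolP ? /asboolP ?; apply/asboolP; apply: Rt; eassumption.
  + by move=> /asboolP ?; apply/asboolP; apply: Ru.
- by move=> z w /aR ?; apply/asboolP.
- by move=> z w /asboolP/Rb.
- by move/(_ x0 y0) => H; move: a0; rewrite H //; apply/asboolP.
- by move/(_ x y bxy)/asboolP.
Qed.

(* If [U = s(A)] is minimal, some [s f] permutes [U]; a power of it is the idempotent. *)
Lemma minimal_set_retract (U : {set car}) : minimal_set A a b U ->
  exists e, [/\ unary_pol e, forall x, e x \in U & forall x, x \in U -> e x = x].
Proof.
move=> [[t [Ut [x0 [y0 [bxy nab]]]]] Umin].
case: (ab) => ac bc sab nba _.
have sU x : upol t x \in U by rewrite Ut imset_f.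
have su : unary_pol (upol t) by exists t.
(* [mu] collects the pairs of [b] that no polynomial [s f] separates modulo [a]. If it contained the
   image under [s] of the given pair, it would absorb [b], and [f = id] would contradict the choice
   of that pair. *)
pose mu x y := b x y /\ forall f, unary_pol f -> a (upol t (f x)) (upol t (f y)).
have [f [fu nf]] : exists f, unary_pol f /\ ~~ a (upol t (f (upol t x0))) (upol t (f (upol t y0))).
  apply: contrapT => nof.
  have mus : mu (upol t x0) (upol t y0).
    split; first exact: (con_unary_pol bc su bxy).
    by move=> f fu; apply: contrapT => /negP nf; apply: nof; exists f.
  case: (ac) => ar' as' at' _; case: (bc) => br' bs' bt' _.
  have : mu x0 y0.
    apply: (@prime_absorb mu) => //.
    - by move=> x y [bx fx]; split; [rewrite bs'|move=> f fu; rewrite as' fx].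
    - move=> x y z [bx fx] [bz fz]; split; first exact: bt' bz.
      by move=> f fu; apply: at' (fx f fu) (fz f fu).
    - move=> u x y uu [bx fx]; split; first exact: (con_unary_pol bc uu bx).
      by move=> f fu; apply: (fx (f \o u)); exact: (unary_pol_comp fu uu).
    - move=> x y axy; split; first exact: sab.
      by move=> f fu; exact: (con_unary_pol ac su (con_unary_pol ac fu axy)).
    - by move=> x y [].
    - exists (upol t x0), (upol t y0); split=> //.
  by case=> _ /(_ id unary_pol_id); apply/negP.
pose h x := upol t (f x).
have hu : unary_pol h by apply: (unary_pol_comp su fu).
have hU x : h x \in U by apply: sU.
(* The image of [U] under [h] is the image of the polynomial [s f s], which still separates the pair
   [x0], [y0]; minimality makes it equal to [U]. *)
have hUU : [set h x | x in U] = U.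
  apply: Umin; last by apply/subsetP => _ /imsetP[x _ ->].
  have [r rE] := unary_pol_comp hu su.
  exists r; split; last first.
    by exists x0, y0; split; rewrite // -!rE.
  apply/setP => z; apply/imsetP/imsetP => [[x]|[x _ ->]].
    rewrite {1}Ut => /imsetP[y _ ->] ->; exists y => //; by rewrite -rE.
  by exists (upol t x) => //; rewrite -rE.
have hinj : {in U &, injective h} by apply/imset_injP; rewrite hUU.
(* Extending [h] by the identity outside [U] gives a permutation of the whole carrier, hence an
   element of finite order. *)
pose pi x := if x \in U then h x else x.
have piinj : injective pi.
  move=> x y; rewrite /pi; case: ifP => xU; case: ifP => yU // e; first exact: hinj.
    by move: (hU x); rewrite e yU.
  by move: (hU y); rewrite -e xU.
pose q := perm piinj; pose k := #[q]%g.
have itu m : unary_pol (iter m h).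
  elim: m => [|m IH]; first exact: unary_pol_id.
  exact: (unary_pol_comp hu IH).
exists (iter k h); split=> // x.
  by rewrite /k -(prednK (order_gt0 q)) /=.
move=> xU; have -> : iter k h x = (q ^+ k)%g x; last by rewrite expg_order perm1.
rewrite permX; have : forall m, iter m h x = iter m q x /\ iter m q x \in U.
  elim=> [|m [IH1 IH2]] //=; rewrite IH1 permE /pi IH2; split=> //.
by move/(_ k) => [].
Qed.

(** * Polynomials into a trace of type 2 *)

Section Type2.
Variables (U N : {set car}) (F : finFieldType) (d : nat) (phi : car -> 'rV[F]_d).
Hypothesis Umin : minimal_set A a b U.
Hypothesis Ntr : is_trace A a b U N.
Hypothesis phiE : forall x y, x \in N -> y \in N -> (phi x == phi y) = a x y.
Hypothesis phi_affine : forall t, induced N t -> exists s : vterm F d, forall v, onN N v ->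
  phi (ev v t) = veval (fun j => phi (v j)) s.

Definition pair_val (T : Type) (x y : T) (j : nat) := if j == 0 then x else y.
Definition bipol (t : pol) x y := ev (pair_val x y) t.
Definition bipol_into_trace t x y :=
  forall x' y', b x x' -> b y y' -> bipol t x' y' \in N.

(** An affine map of two variables is a sum of two maps of one variable each. *)
Lemma veval_mixed (s : vterm F d) p p' q q' :
  (veval (pair_val p q) s - veval (pair_val p q') s =
   veval (pair_val p' q) s - veval (pair_val p' q') s)%R.
Proof.
elim: s => [j|c||s IHs u IHu|s IHs|r s IHs] //=.
- by case: j => [|j]; rewrite /pair_val /= ?subrr.
- by rewrite !opprD addrACA IHs IHu addrACA.
- by rewrite -!opprD IHs.
- by rewrite -!scalerBr IHs.
Qed.

Lemma subr_swap (V : zmodType) (x y z t : V) : (x - y = z - t -> x - z = y - t)%R.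
Proof.
by move=> h; rewrite -[x](subrK y) h addrAC [(z - t)%R]addrC addrK addrC.
Qed.

Lemma trace_rel x y : x \in N -> y \in N -> b x y.
Proof.
case: Ntr => u [_ -> _]; rewrite !inE => /andP[_ ux] /andP[_ uy].
case: ab => _ [_ bs bt _] _ _ _; apply: bt uy; by rewrite bs.
Qed.

Lemma trace_block x y : x \in N -> b x y -> y \in U -> y \in N.
Proof.
case: Ntr => u [_ -> _]; rewrite !inE => /andP[_ ux] xy ->.
by case: ab => _ [_ bs bt _] _ _ _; apply: bt xy.
Qed.

Definition pol_left (t s : pol) := psubst t (pair_val (psubst s (fun=> PVar ar car 0)) (PVar ar car 1)).
Definition pol_right (t s : pol) := psubst t (pair_val (PVar ar car 0) (psubst s (fun=> PVar ar car 1))).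

Lemma bipol_left t s x y : bipol (pol_left t s) x y = bipol t (upol s x) y.
Proof.
rewrite /bipol /pol_left pteval_psubst; congr pteval; apply: funext => j.
by rewrite /pair_val; case: eqP => //= _; rewrite pteval_psubst.
Qed.

Lemma bipol_right t s x y : bipol (pol_right t s) x y = bipol t x (upol s y).
Proof.
rewrite /bipol /pol_right pteval_psubst; congr pteval; apply: funext => j.
by rewrite /pair_val; case: eqP => //= _; rewrite pteval_psubst.
Qed.

(* Type 2 makes mixed differences vanish on the trace; the pairs for which they vanish
   form a congruence, first in one variable and then in the other. *)
Lemma bipol_mixed t x x' y y' : b x x' -> b y y' -> bipol_into_trace t x y ->
  (phi (bipol t x y) - phi (bipol t x y') = phi (bipol t x' y) - phi (bipol t x' y'))%R.
Proof.
case: (ab) => ac bc sab _ _; case: (ac) => ar' as' at' _; case: (bc) => br' bs' bt' _.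
have [n0 [m0 [nN0 mN0 nm0]]] : exists x y, [/\ x \in N, y \in N & ~~ a x y].
  by case: Ntr => u [].
pose f t x y := phi (bipol t x y).
have bip r t1 x1 x2 y1 y2 : is_con A r -> r x1 x2 -> r y1 y2 ->
    r (bipol t1 x1 y1) (bipol t1 x2 y2).
  by move=> rc r1 r2; apply: con_pteval => // j; rewrite /pair_val; case: eqP.
have intoE t1 x1 x2 y1 y2 : b x1 x2 -> b y1 y2 -> bipol_into_trace t1 x1 y1 ->
    bipol_into_trace t1 x2 y2.
  by move=> b1 b2 it x3 y3 b3 b4; apply: it; [apply: bt' b3|apply: bt' b4].
have fE t1 x1 x2 y1 y2 : a x1 x2 -> a y1 y2 -> bipol_into_trace t1 x1 y1 ->
    f t1 x1 y1 = f t1 x2 y2.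
  move=> a1 a2 it; apply/eqP; rewrite phiE; first exact: bip.
    by apply: it.
  by apply: it; apply: sab.
(* Here the first variable is confined to [N] and the second moves in its [b]-block. When the second
   also moves inside [N], the polynomial is induced on the trace and [phi_affine] applies;
   [prime_absorb] does the rest. *)
have step2 y1 y2 : b y1 y2 -> forall t n n', n \in N -> n' \in N ->
    bipol_into_trace t n y1 -> (f t n y1 - f t n' y1 = f t n y2 - f t n' y2)%R.
  pose R y1 y2 := b y1 y2 /\ forall t n n', n \in N -> n' \in N ->
    bipol_into_trace t n y1 -> (f t n y1 - f t n' y1 = f t n y2 - f t n' y2)%R.
  suff H : forall y1 y2, b y1 y2 -> R y1 y2 by move=> /H[].
  apply: prime_absorb => //.
  - move=> z w [bzw H]; split=> [|t1 n n' nN n'N it]; first by rewrite bs'.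
    by rewrite H //; apply: intoE it; rewrite // bs'.
  - move=> z w q [b1 H1] [b2 H2]; split=> [|t1 n n' nN n'N it]; first exact: bt' b2.
    by rewrite H1 // H2 //; apply: intoE it.
  - move=> u z w uu [b1 H1]; split=> [|t1 n n' nN n'N it]; first exact: (con_unary_pol bc uu b1).
    have [s us] := uu; rewrite /f !us -!bipol_right; apply: H1 => // x3 y3 b3 b4.
    by rewrite bipol_right -us; apply: it => //; apply: (con_unary_pol bc uu b4).
  - move=> z w azw; split=> [|t1 n n' nN n'N it]; first exact: sab.
    rewrite (fE t1 n n z w) // (fE t1 n' n' z w) //.
    by apply: intoE it => //; apply: trace_rel.
  - by move=> z w [].
  exists n0, m0; split=> //; split=> [|t1 n n' nN n'N it]; first exact: trace_rel.
  (* [bipol] reads every variable other than 0 as the second argument, whereas [induced] speaks of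
     arbitrary assignments; [t2] merges all these variables into variable 1. *)
  pose t2 := psubst t1 (pair_val (PVar ar car 0) (PVar ar car 1)).
  have t2E v : ev v t2 = bipol t1 (v 0) (v 1).
    rewrite pteval_psubst; congr pteval; apply: funext => j.
    by rewrite /pair_val; case: eqP.
  have ind : induced N t2.
    by move=> v vN; rewrite t2E; apply: it; apply: trace_rel.
  have [s sE] := phi_affine ind.
  have fs v1 w1 : v1 \in N -> w1 \in N -> f t1 v1 w1 = veval (pair_val (phi v1) (phi w1)) s.
    move=> xN yN; rewrite /f -[bipol _ _ _]/(bipol t1 (pair_val v1 w1 0) (pair_val v1 w1 1)) -t2E sE.
      by congr veval; apply: funext => j; rewrite /pair_val; case: eqP.
    by move=> j; rewrite /pair_val; case: eqP.
  by rewrite !fs //; apply/subr_swap/veval_mixed.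
(* The same argument in the first variable: its starting pair lies in [N], where [step2] applies
   after the roles of the two differences are exchanged. *)
pose R x1 x2 := b x1 x2 /\ forall t y y', b y y' -> bipol_into_trace t x1 y ->
  (f t x1 y - f t x1 y' = f t x2 y - f t x2 y')%R.
suff H : forall x1 x2, b x1 x2 -> R x1 x2 by move=> bx bY it; have [_] := H _ _ bx; apply.
apply: prime_absorb => //.
- move=> z w [bzw H]; split=> [|t1 y1 y2 by1 it]; first by rewrite bs'.
  by rewrite H //; apply: intoE it; rewrite // bs'.
- move=> z w q [b1 H1] [b2 H2]; split=> [|t1 y1 y2 by1 it]; first exact: bt' b2.
  by rewrite H1 // H2 //; apply: intoE it.
- move=> u z w uu [b1 H1]; split=> [|t1 y1 y2 by1 it]; first exact: (con_unary_pol bc uu b1).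
  have [s us] := uu; rewrite /f !us -!bipol_left; apply: H1 => // x3 y3 b3 b4.
  by rewrite bipol_left -us; apply: it => //; apply: (con_unary_pol bc uu b3).
- move=> z w azw; split=> [|t1 y1 y2 by1 it]; first exact: sab.
  rewrite (fE t1 z w y1 y1) // (fE t1 z w y2 y2) //.
  exact: intoE it.
- by move=> z w [].
exists n0, m0; split=> //; split=> [|t1 y1 y2 by1 it]; first exact: trace_rel.
by apply: subr_swap; apply: step2.
Qed.

(** With all arguments but two fixed, [u] after the operation is a binary polynomial into the trace,
    so its mixed differences vanish and [additive_decomposition] applies. *)
Lemma op_additive (u : car -> car) i (o : 'I_(ar i) -> car) : unary_pol u ->
  (forall y, b (@fops _ _ A i o) y -> u y \in N) ->
  forall v, (forall k, b (o k) (v k)) ->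
  (phi (u (fops v)) =
   phi (u (fops o)) + \sum_k (phi (u (fops (upd o k (v k)))) - phi (u (fops o))))%R.
Proof.
case: (ab) => _ [br' bs' bt' bo'] _ _ _ [t tu] uN v ov.
apply: (@additive_decomposition _ _ _ (fun k => b (o k)) (fun v => phi (u (fops v))) o) => //.
move=> {ov}v {}i' j x x' y y' ij vB ox ox' oy oy'.
pose s := psubst t (fun=> POp (fun k => if k == j then PVar ar car 1 else
                              if k == i' then PVar ar car 0 else PCst ar (v k))).
have sE z w : u (fops (upd (upd v i' z) j w)) = bipol s z w.
  rewrite tu /upol /bipol /s pteval_psubst /=; congr pteval; apply: funext => _.
  congr fops; apply: funext => k; rewrite /upd; case: eqP => //; by case: eqP.
rewrite !sE; apply: bipol_mixed.
- by apply: bt' ox'; rewrite bs'.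
- by apply: bt' oy'; rewrite bs'.
move=> x1 y1 b1 b2; rewrite -sE; apply: uN; apply: bo' => k; rewrite /upd.
case: eqP => [->|_]; first exact: bt' b2.
by case: eqP => [->|_] //; apply: bt' b1.
Qed.

(** The pairs of [b] not separated by such [u] form a congruence. Were it larger than [a], it would
    contain a pair of [N] outside [a]; but the retraction onto [U] fixes that pair and maps its
    block into [N]. *)
Lemma trace_separates x y : b x y ->
  (forall u, unary_pol u -> (forall z, b x z -> u z \in N) -> a (u x) (u y)) -> a x y.
Proof.
case: (ab) => ac bc sab _ _; case: (ac) => ar' as' at' _; case: (bc) => br' bs' bt' _.
move=> bxy H; apply: contrapT => /negP naxy.
have [n0 [m0 [nN0 mN0 nm0]]] : exists x y, [/\ x \in N, y \in N & ~~ a x y].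
  by case: Ntr => u [].
pose R x y := b x y /\ forall u, unary_pol u -> (forall z, b x z -> u z \in N) -> a (u x) (u y).
suff : R n0 m0.
  have [e [eu eU eI]] := minimal_set_retract Umin.
  have NU z : z \in N -> z \in U by case: Ntr => u [_ -> _]; rewrite !inE => /andP[].
  case=> _ /(_ e eu); rewrite !eI ?NU // => K; move: nm0; rewrite K // => z bz.
  by apply: (trace_block nN0) => //; rewrite -(eI n0) ?NU //; apply: (con_unary_pol bc eu bz).
have bnm : b n0 m0 by exact: trace_rel.
move: bnm; move: n0 m0 {nN0 mN0 nm0}; apply: prime_absorb => //.
- move=> z w [bzw K]; split=> [|u uu uN]; first by rewrite bs'.
  by rewrite as'; apply: K => // t bt; apply: uN; apply: bt' bt; rewrite bs'.
- move=> z w t [b1 H1] [b2 H2]; split=> [|u uu uN]; first exact: bt' b2.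
  apply: at' (H1 u uu uN) _; apply: H2 => // r br; apply: uN; exact: bt' br.
- move=> u z w uu [b1 H1]; split=> [|f fu fN]; first exact: (con_unary_pol bc uu b1).
  apply: (H1 (f \o u)); first exact: (unary_pol_comp fu uu).
  by move=> t bt; apply: fN; apply: (con_unary_pol bc uu bt).
- by move=> z w azw; split=> [|u uu _]; [exact: sab|exact: (con_unary_pol ac uu azw)].
- by move=> z w [].
by exists x, y.
Qed.

End Type2.
End Prime.

End Polynomials.

(** * Coordinates over a prime field *)

(** The trace is a space over an arbitrary finite field, while gates compute over a prime field.
    Only additivity matters later, so [F] is viewed as a vector space over its prime subfield. *)
Lemma prime_coordinates (F : finFieldType) d : exists p (C : finType) (chi : C -> 'rV[F]_d -> 'F_p),
  [/\ prime p, forall c, additive (chi c) &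
    forall v w, (forall c, chi c v = chi c w) -> v = w].
Proof.
have [p pp pF] := finPcharP F.
pose W : vectType 'F_p := pPrimeCharType pF.
pose co (j : 'I_(\dim {:W})) (z : W) : 'F_p := coord (vbasis {:W}) j z.
exists p, ('I_d * 'I_(\dim {:W}))%type, (fun c v => co c.2 (v ord0 c.1)); split=> //.
  by move=> c v w; rewrite !mxE /co; exact: raddfB.
move=> v w H; apply/rowP => i.
rewrite [LHS](coord_vbasis (memvf (v ord0 i : W))) [RHS](coord_vbasis (memvf (w ord0 i : W))).
by apply: eq_bigr => j _; have := H (i, j); rewrite /co /= => ->.
Qed.

(** A coordinate is a function [u] together with a component [chi]. It is read off [phi (u x)] where
    [u] is a polynomial mapping the [d]-block of [x] into [N], and is 0 elsewhere. There are
    finitely many functions [u], and the family is stable under composition with an operation in one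
    argument. *)
Theorem affine_coordinates (I : finType) (ar : I -> nat) (A : finAlg ar) (g d : rel (fcar A)) :
  prime_quot A g d -> type2 A g d ->
  exists p (Z : finType) (X : Z -> fcar A -> 'F_p), [/\ prime p,
    forall x y, g x y -> forall z, X z x = X z y,
    forall x y, d x y -> (forall z, X z x = X z y) -> g x y &
    forall i (o : 'I_(ar i) -> fcar A) z, exists (ka : 'F_p) (zk : 'I_(ar i) -> option Z),
      forall v, (forall k, d (o k) (v k)) ->
      X z (fops v) = (ka + \sum_k oapp (fun z' => X z' (v k)) 0 (zk k))%R].
Proof.
move=> gd [U [N [F [dm [phi [Umin [Ntr [phiE [_ [phia _]]]]]]]]]].
case: (gd) => gc dc sgd _ _; case: (gc) => gr gs gt _; case: (dc) => dr ds dt dop.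
have [p [C [chi [pp chiD chiI]]]] := prime_coordinates F dm.
pose good (u : {ffun fcar A -> fcar A}) x := unary_pol u /\ forall y, d x y -> u y \in N.
have goodE u x y : d x y -> good u x -> good u y.
  by move=> dxy [uu uN]; split=> // z dyz; apply: uN; apply: dt dyz.
pose X (z : {ffun fcar A -> fcar A} * C) x := if `[<good z.1 x>] then chi z.2 (phi (z.1 x)) else 0%R.
exists p, ({ffun fcar A -> fcar A} * C)%type, X; split=> //.
- move=> x y gxy [u c]; rewrite /X /=; have dxy := sgd _ _ gxy.
  have -> : `[<good u y>] = `[<good u x>].
    by apply/asboolP/asboolP; apply: goodE; rewrite // ds.
  case: asboolP => // -[uu uN]; congr chi; apply/eqP; rewrite phiE ?uN //.
  exact: (con_unary_pol gc uu gxy).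
- move=> x y dxy H; apply: (trace_separates gd Umin Ntr) => // u uu uN.
  have gx : good [ffun z => u z] x.
    by split=> [|z xz]; rewrite ?ffunE ?uN //; case: uu => t tu; exists t => z; rewrite ffunE.
  rewrite -phiE ?uN //; apply/eqP/chiI => c.
  have := H ([ffun z => u z], c); rewrite /X /= !asboolT ?ffunE //.
  exact: goodE gx.
move=> i o [u c]; rewrite /X /=.
have [go|ngo] := pselect (good u (fops o)); last first.
  (* All results lie in the [d]-block of [fops o], where [u] is not admissible, so the coordinate is
     0 throughout. *)
  exists 0%R, (fun=> None) => v ov; rewrite big1 // addr0 asboolF // => gv.
  by apply: ngo; apply: goodE gv; rewrite ds; apply: dop.
have [uu uN] := go.
pose uk k : {ffun fcar A -> fcar A} := [ffun x => u (fops (upd o k x))].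
(* The differences in [op_additive] subtract the base value once per argument; these copies go into
   the constant, and a coordinate [uk k] of the [k]-th argument remains. *)
exists (chi c (phi (u (fops o))) - \sum_(k < ar i) chi c (phi (u (fops o))))%R, (fun k => Some (uk k, c)).
move=> v ov; rewrite asboolT; last by apply: goodE go; apply: dop.
rewrite (op_additive gd Ntr phiE phia uu uN ov).
have chi0 : chi c 0%R = 0%R by rewrite -(subrr 0%R) chiD subrr.
have chiN w : chi c (- w)%R = (- chi c w)%R by rewrite -[(- w)%R]sub0r chiD chi0 sub0r.
have chiA w w' : chi c (w + w')%R = (chi c w + chi c w')%R.
  by rewrite -{1}[w']opprK chiD chiN opprK.
rewrite chiA (big_morph (chi c) chiA chi0) -addrA; congr (_ + _)%R.
under eq_bigr do rewrite chiD; rewrite big_split /= sumrN addrC; congr (_ + _)%R.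
apply: eq_bigr => k _; rewrite asboolT ?ffunE //; split=> [|y vy].
  have [t tu] := unary_pol_comp uu (unary_pol_upd o k).
  by exists t => x; rewrite ffunE -tu.
rewrite ffunE; apply: uN; apply: dop => j; rewrite /upd; case: eqP => [->|_] //.
exact: dt vy.
Qed.

(** * Circuits of layers for the quotients of a finite algebra *)

Lemma layers_weaken n ps (T : finType) Spec s s' : s <= s' ->
  @layers_realize n ps T Spec s -> @layers_realize n ps T Spec s'.
Proof. by move=> ss [C [h1 h2 h3 h4 h5]]; exists C; split=> //; apply: leq_trans ss. Qed.

(** [R] constrains each output bit separately, for every assignment [Y], so the gates are chosen one
    by one and their joint meaning is recovered only in [Spec']. *)
Lemma layers_step n ps (T T' : finType) Spec Spec' s p q
    (R : T' -> (nat -> bool) -> bool -> Prop) :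
  @layers_realize n ps T Spec s ->
  (forall t', exists g : babp p, [/\ babp_wf #|T| g, babp_size g <= q &
     forall Y, R t' Y (babp_eval Y g)]) ->
  (forall (x Y : nat -> bool) y', Spec x (fun t => Y (enum_rank t)) ->
     (forall t', R t' Y (y' t')) -> Spec' x y') ->
  @layers_realize n (p :: ps) T' Spec' (s + #|T'| * q).
Proof.
move=> rl /choice[G GP] SS; apply: (layers_push (G := G) rl) => [t'|x Y Sx].
  by have [] := GP t'.
by apply: SS Sx _ => t'; have [_ _] := GP t'; apply.
Qed.

(** Single-edge programs copy the selected monotone nodes, which makes the top layer indexed by
    [T]. *)
Lemma layers_base n (T : finType) Spec mc (pos : T -> nat) :
  mcirc_wf n mc -> (forall t, pos t < size mc) ->
  (forall x, Spec x (fun t => nth false (mvals x mc) (pos t))) ->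
  @layers_realize n [:: 2] T Spec (msize mc + #|T| * 3).
Proof.
move=> mwf posm SP.
pose g t := @Babp 2 2 [:: (0, 1, AVar 2 (pos t))] [set 1%R].
pose C := @ItCirc [:: 2] mc (fun k => match k return seq (babp (nth 2 [:: 2] k)) with
  | 0 => [seq g t | t <- enum T] | _.+1 => [::] end).
exists C; split=> //.
- by rewrite size_map -cardE.
- case=> // _; rewrite /= all_map; apply/allP => t _ /=.
  by rewrite /babp_wf /= posm.
- rewrite /it_size leq_add2l big_ord_recl big_ord0 addn0 big_map big_enum /=.
  by rewrite -sum_nat_const leq_sum.
move=> x; rewrite (_ : (fun t => _) = (fun t => nth false (mvals x mc) (pos t))) //.
apply: funext => t; rewrite [it_vals _ _ _]/=.
rewrite -map_comp nth_enum_rank /= /babp_eval /babp_value /= big_cons big_nil /=.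
by rewrite addr0 mul1r inE; case: nth.
Qed.

(** * Descending through one cover of type 2 *)

Section Levels.
Variables (I : finType) (ar : I -> nat) (A : finAlg ar) (io : bool -> fcar A).
Notation car := (fcar A).

Definition circ_nodes_wf n (c : seq (cnode A)) :=
  forall k, k < size c -> cnode_wf n k (nth (CVar A 0) c k).

(** The inputs travel along with the class bits: they are needed as labels at input nodes and, at
    the end, to recognize the constant words. *)
Definition wires n (c : seq (cnode A)) : finType := ('I_(size c) * car + 'I_n)%type.

Definition class_spec n c (th : rel car) (x : nat -> bool) (y : wires n c -> bool) :=
  (forall j, y (inr j) = x j) /\
  (mixed_input n x -> forall m a, y (inl (m, a)) = th (node_value io c x m) a).

(** The primes and the bound precede [n] and [c]: the sequence of layers must not depend on the word
    length. *)
Definition layered th := exists ps F, [/\ all prime ps, polybound F &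
  forall n c, 0 < n -> 0 < size c -> circ_nodes_wf n c ->
    @layers_realize n ps (wires n c) (@class_spec n c th) (F (n + size c))].

Definition class_rep (d : rel car) v := odflt v [pick w | d v w].

Lemma class_repP d v : is_con A d -> d v (class_rep d v).
Proof. by move=> [dr _ _ _]; rewrite /class_rep; case: pickP. Qed.

Lemma eq_class_rep d v w : is_con A d -> d v w -> class_rep d v = class_rep d w.
Proof.
move=> [dr ds dt _] vw; rewrite /class_rep.
rewrite (eq_pick (Q := d w)); last first.
  by move=> z; apply/idP/idP; apply: dt; rewrite // ds.
by case: pickP => //= /(_ w); rewrite dr.
Qed.

Definition op_instance : finType := {i : I & {ffun 'I_(ar i) -> car}}.

Definition node_arg (nd : cnode A) (k : nat) : nat :=
  match nd with COp i args => if insub k is Some k' then args k' else 0 | _ => 0 end.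

Lemma node_argE i args (k : 'I_(ar i)) : node_arg (COp A args) k = args k.
Proof. by rewrite /node_arg valK. Qed.

Section LinearLayer.
Variables (d : rel car) (p : nat) (Z : finType) (X : Z -> car -> 'F_p).
Hypothesis dcon : is_con A d.
Hypothesis pp : prime p.
Variables (cst : forall i, {ffun 'I_(ar i) -> car} -> Z -> 'F_p)
  (src : forall i, {ffun 'I_(ar i) -> car} -> Z -> 'I_(ar i) -> option Z).
Hypothesis opE : forall i (o : {ffun 'I_(ar i) -> car}) z v, (forall k, d (o k) (v k)) ->
  X z (fops v) = (cst o z + \sum_k oapp (fun z' => X z' (v k)) 0 (src o z k))%R.

Variables (n : nat) (c : seq (cnode A)) (n0 : 'I_n) (c0 : 'I_(size c)).
Hypothesis wfc : circ_nodes_wf n c.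

(** An edge label is a single bit, so the condition that all arguments of a node lie in the classes
    of a given tuple has to be computed one layer below. *)
Definition joint_wires : finType := (wires n c + 'I_(size c) * op_instance)%type.
(** Gates output bits, hence the one-hot encoding of coordinates by their values in ['F_p]. *)
Definition coord_wires : finType := (wires n c + 'I_(size c) * Z * 'F_p)%type.

Definition ordc k : 'I_(size c) := insubd c0 k.
Definition ordn k : 'I_n := insubd n0 k.

Definition joint_spec x (y : joint_wires -> bool) :=
  class_spec d x (fun t => y (inl t)) /\
  (mixed_input n x -> forall m (t : op_instance), y (inr (m, t)) =
    [forall k, d (node_value io c x (ordc (node_arg (nth (CVar A 0) c m) (val k)))) (tagged t k)]).

Definition coord_spec x (y : coord_wires -> bool) :=
  class_spec d x (fun t => y (inl t)) /\
  (mixed_input n x -> forall m z f, y (inr (m, z, f)) = (X z (node_value io c x m) == f)).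

(** A label cannot be a constant times a bit; the multiple [cst w z] of the selector is realized by
    that many parallel edges from the source. *)
Definition op_edges (m : 'I_(size c)) (z : Z) i (args : 'I_(ar i) -> nat)
    (w : {ffun 'I_(ar i) -> car}) : seq (option ('I_(size c) * Z) * (joint_wires + 'F_p)) :=
  let l := inl (inr (m, Tagged (fun i => {ffun 'I_(ar i) -> car}) w)) in
  nseq (cst w z) (None, l) ++
  pmap (fun k => omap (fun z' => (Some (ordc (args k), z'), l)) (src w z k)) (enum 'I_(ar i)).

(** Tuples run over class representatives only, so exactly one selector of an operation node is 1.
    At an input node the edges interpolate between [io false] and [io true]. *)
Definition node_edges (v : 'I_(size c) * Z) : seq (option ('I_(size c) * Z) * (joint_wires + 'F_p)) :=
  match nth (CVar A 0) c v.1 with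
  | CConst a => [:: (None, inr (X v.2 a))]
  | CVar j => (None, inr (X v.2 (io false))) ::
      nseq (X v.2 (io true) - X v.2 (io false))%R (None, inl (inl (inr (ordn j))))
  | COp i args => flatten [seq op_edges v.1 v.2 args w | w : {ffun 'I_(ar i) -> car} <-
      enum {: {ffun 'I_(ar i) -> car}} & [forall k, class_rep d (w k) == w k]]
  end.

Definition edge_bound := p.+1 + \sum_i #|{ffun 'I_(ar i) -> car}| * (p + ar i).

Lemma Fp_lt (f : 'F_p) : f < p.
Proof. by rewrite -[X in _ < X](Fp_cast pp) ltn_ord. Qed.

Lemma Fp_natr (f : 'F_p) : (f%:R = f)%R.
Proof. exact: natr_Zp. Qed.

Lemma size_nseq_Fp T (f : 'F_p) (e : T) : size (nseq f e) <= p.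
Proof. by rewrite size_nseq ltnW ?Fp_lt. Qed.

Lemma node_edges_size v : size (node_edges v) <= edge_bound.
Proof.
rewrite /node_edges /edge_bound; case: nth => [j|a|i args].
- apply: leq_trans (leq_addr _ _); exact: (size_nseq_Fp (X v.2 (io true) - X v.2 (io false))%R).
- by rewrite addSn.
apply: leq_trans (leq_addl _ _); rewrite (bigD1 i) //=.
apply: leq_trans (leq_addr _ _); rewrite size_flatten /shape -map_comp sumnE big_map.
rewrite big_filter big_enum_cond /= big_mkcond /= -sum_nat_const.
apply: leq_sum => w _; case: ifP => // _.
rewrite /op_edges size_cat; apply: leq_add; first exact: size_nseq_Fp.
by rewrite size_pmap (leq_trans (count_size _ _)) // -cardE card_ord.
Qed.

Lemma node_edges_rank v u l : (Some u, l) \in node_edges v -> u.1 < v.1.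
Proof.
rewrite /node_edges; have := wfc (ltn_ord v.1).
case: nth => [j _|a _|i args /forallP argP].
- by rewrite inE mem_nseq andbC => /orP[/eqP|/andP[/eqP]].
- by rewrite inE => /eqP.
case/flatten_mapP => w _; rewrite mem_cat mem_nseq => /orP[/andP[_ /eqP]//|].
rewrite mem_pmap => /mapP[k _]; case: (src w v.2 k) => //= z' [-> _] /=.
by rewrite /ordc insubdK //; apply: ltn_trans (ltn_ord v.1).
Qed.

Lemma node_edges_value x (Y : nat -> bool) (v : 'I_(size c) * Z) : mixed_input n x ->
  joint_spec x (fun t => Y (enum_rank t)) ->
  X v.2 (node_value io c x v.1) =
  (\sum_(e <- node_edges v) oapp (fun u : 'I_(size c) * Z => X u.2 (node_value io c x u.1)) 1 e.1
     * alab_val Y (in_label e.2))%R.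
Proof.
move=> ok [[yin /(_ ok) ycl] /(_ ok) yj].
rewrite (node_valueE _ _ wfc (ltn_ord v.1)) /node_edges; have := wfc (ltn_ord v.1).
have yjv := yj v.1.
case: nth yjv => [j _ jn|a _ _|i args yjv /forallP argP].
- rewrite big_cons big_nseq iter_addr addr0 !mul1r [alab_val _ _]/= [alab_val _ _]/= yin.
  rewrite /ordn insubdK //; set f := X _ _; set h := X _ _; set e := X _ _.
  rewrite /f /h /e; case: (x j); last by rewrite mul0rn addr0.
  by rewrite Fp_natr addrC subrK.
- by rewrite big_seq1 /= mul1r.
rewrite big_flatten big_map big_filter big_enum_cond /=.
have argo k : ordc (args k) = args k :> nat.
  by rewrite insubdK //; apply: ltn_trans (argP k) (ltn_ord _).
(* The only tuple of representatives that fits the actual arguments; all other summands vanish. *)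
pose w0 : {ffun 'I_(ar i) -> car} := [ffun k => class_rep d (node_value io c x (args k))].
have jE w : Y (enum_rank (inr (v.1, Tagged (fun i => {ffun 'I_(ar i) -> car}) w) : joint_wires)) =
    [forall k, d (node_value io c x (args k)) (w k)].
  by rewrite yjv; apply: eq_forallb => k; rewrite node_argE argo.
have eE w : (\sum_(e <- op_edges v.1 v.2 args w)
     oapp (fun u : 'I_(size c) * Z => X u.2 (node_value io c x u.1)) 1 e.1 * alab_val Y (in_label e.2))%R =
   ((cst w v.2 + \sum_k oapp (fun z' => X z' (node_value io c x (args k))) 0 (src w v.2 k)) *
    [forall k, d (node_value io c x (args k)) (w k)]%:R)%R.
  rewrite /op_edges big_cat big_nseq iter_addr addr0 /= mul1r jE mulrDl; congr (_ + _)%R.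
    by rewrite -[in RHS](Fp_natr (cst w v.2)) mulr_natl.
  rewrite mulr_suml -[in RHS]big_enum /=; elim: (enum _) => [|k s IH]; first by rewrite !big_nil.
  rewrite big_cons /= -IH; case: (src w v.2 k) => [z'|] /=; last by rewrite mul0r add0r.
  by rewrite big_cons /= jE argo.
have [dr ds dt _] := dcon.
rewrite (bigD1 w0) /=; last first.
  by apply/forallP => k; rewrite ffunE; apply/eqP/esym/eq_class_rep => //; apply: class_repP.
rewrite [X in (_ + X)%R]big1 ?addr0 => [|w /andP[/forallP wrep ww0]].
  rewrite eE (_ : [forall k, _] = true) ?mulr1.
    by apply: opE => k; rewrite ffunE ds; apply: class_repP.
  by apply/forallP => k; rewrite ffunE; apply: class_repP.
rewrite eE (_ : [forall k, _] = false) ?mulr0 //; apply/negbTE; apply: contra ww0 => /forallP dw.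
apply/eqP/ffunP => k; rewrite ffunE -(eqP (wrep k)); apply/esym/eq_class_rep => //.
Qed.

End LinearLayer.

Lemma joint_layer n c d ps s (c0 : 'I_(size c)) p : prime p ->
  @layers_realize n ps (wires n c) (@class_spec n c d) s ->
  @layers_realize n (p :: ps) (joint_wires n c) (@joint_spec d n c c0)
    (s + #|joint_wires n c| * ((\sum_i ar i).*2 + 3)).
Proof.
move=> pp rl.
pose lits (t : joint_wires n c) : seq (wires n c) := match t with
  | inl t' => [:: t']
  | inr (m, tau) => [seq inl (ordc c0 (node_arg (nth (CVar A 0) c m) (val k)), tagged tau k)
                    | k <- enum 'I_(ar (tag tau))] end.
apply: (layers_step (R := fun t Y b => b = all (fun u => Y (enum_rank u)) (lits t)) rl).
  move=> t; have [g [gw gs gv]] := and_gate (lits t) pp.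
  exists g; split=> //; apply: leq_trans gs _.
  rewrite addnS addn2 ltnS; case: (t) => [t'|[m tau]] //=; apply: leqW; apply: leqW.
  rewrite leq_double size_map -cardE card_ord.
  by rewrite [leqRHS](bigD1 (tag tau)) //= leq_addr.
move=> x Y y' [yin ycl] yE.
have yl t : y' (inl t) = Y (enum_rank t) by rewrite yE /= andbT.
split=> [|ok m tau].
  split=> [j|ok m a]; first by rewrite yl yin.
  by rewrite yl ycl.
rewrite yE /= all_map; apply/allP/forallP => H k.
  by have := H k (mem_enum _ _); rewrite /= ycl.
by move=> _ /=; rewrite ycl.
Qed.

Lemma coord_layer n c d p (Z : finType) (X : Z -> car -> 'F_p)
    (cst : forall i, {ffun 'I_(ar i) -> car} -> Z -> 'F_p)
    (src : forall i, {ffun 'I_(ar i) -> car} -> Z -> 'I_(ar i) -> option Z)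
    ps s (n0 : 'I_n) (c0 : 'I_(size c)) :
  is_con A d -> prime p -> circ_nodes_wf n c ->
  (forall i (o : {ffun 'I_(ar i) -> car}) z v, (forall k, d (o k) (v k)) ->
    X z (fops v) = (cst i o z + \sum_k oapp (fun z' => X z' (v k)) 0 (src i o z k))%R) ->
  @layers_realize n ps (joint_wires n c) (@joint_spec d n c c0) s ->
  @layers_realize n (p :: ps) (coord_wires p Z n c) (@coord_spec d p Z X n c)
    (s + #|coord_wires p Z n c| * ((size c * #|Z|) * (edge_bound p).+1 + 3)).
Proof.
move=> dcon pp wfc opE rl.
pose W : finType := ('I_(size c) * Z)%type.
pose inE (v : W) := node_edges d X cst src n0 c0 v.
(* A coordinate bit is described through every solution [w] of the vertex equations; the true
   coordinates are supplied as a solution at the end. *)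
pose R (t : coord_wires p Z n c) (Y : nat -> bool) b := match t with
  | inl t' => b = Y (enum_rank (inl t' : joint_wires n c))
  | inr (m, z, f) => forall w : W -> 'F_p,
      (forall v, w v = (\sum_(e <- inE v) oapp w 1 e.1 * alab_val Y (in_label e.2))%R) ->
      b = (w (m, z) == f) end.
apply: (layers_step (R := R) rl) => [[t|[[m z] f]]|].
- have [g [gw gs gv]] := and_gate [:: inl t : joint_wires n c] pp.
  exists g; split=> // [|Y]; first by apply: leq_trans gs _; rewrite leq_addl.
  by rewrite /R gv /= andbT.
- have rk (v u : W) l : (Some u, l) \in inE v -> val u.1 < val v.1.
    exact: node_edges_rank.
  have [g [gw gs gt gv]] := vertex_gate (m, z) [set f] rk.
  exists g; split=> // [|Y w wE].
    apply: leq_trans gs _; rewrite mulnS.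
    have H : \sum_v size (inE v) <= size c * #|Z| * edge_bound p.
      rewrite -[X in X * #|Z|]card_ord -card_prod -sum_nat_const.
      by apply: leq_sum => v _; apply: node_edges_size.
    apply: (@leq_trans ((size c * #|Z|).+1 + size c * #|Z| * edge_bound p)); last by lia.
    by rewrite leq_add // card_prod card_ord.
  by rewrite /babp_eval gt in_set1 (gv Y w wE).
move=> x Y y' js yE.
have yl t : y' (inl t) = Y (enum_rank (inl t : joint_wires n c)) := yE (inl t).
have [[yin ycl] _] := js.
split=> [|ok m z f].
  split=> [j|ok m a]; first by rewrite yl yin.
  by rewrite yl ycl.
have := yE (inr (m, z, f)) => /(_ (fun v => X v.2 (node_value io c x v.1))); apply => v.
exact: (node_edges_value dcon opE n0 wfc).
Qed.

Lemma refine_layer n c g d p (Z : finType) (X : Z -> car -> 'F_p) ps s : prime p ->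
  (forall x y, g x y = d x y && [forall z, X z x == X z y]) ->
  @layers_realize n ps (coord_wires p Z n c) (@coord_spec d p Z X n c) s ->
  @layers_realize n (p :: ps) (wires n c) (@class_spec n c g)
    (s + #|wires n c| * (#|Z|.*2 + 3)).
Proof.
move=> pp gE rl.
pose lits (t : wires n c) : seq (coord_wires p Z n c) := match t with
  | inl (m, a) => inl (inl (m, a)) :: [seq inr (m, z, X z a) | z <- enum Z]
  | inr j => [:: inl (inr j)] end.
apply: (layers_step (R := fun t Y b => b = all (fun u => Y (enum_rank u)) (lits t)) rl).
  move=> t; have [h [hw hs hv]] := and_gate (lits t) pp.
  exists h; split=> //; apply: leq_trans hs _.
  rewrite addnS addn2 ltnS; case: (t) => [[m a]|j] //=.
  by rewrite size_map -cardE doubleS.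
move=> x Y y' [[yin ycl] yX] yE; split=> [j|ok m a].
  by rewrite yE /= andbT yin.
rewrite yE /= ycl // gE; congr (_ && _); rewrite all_map.
apply/allP/forallP => H z; first by have := H z (mem_enum _ _); rewrite /= yX.
by move=> _ /=; rewrite yX.
Qed.

(** Three layers over the same prime: selectors of the affine maps, coordinates of all nodes, and
    conjunctions of a [d]-class with coordinates. *)
Lemma layered_prime_step g d : prime_quot A g d -> type2 A g d -> layered d -> layered g.
Proof.
move=> gd t2; have [p [Z [X [pp Xg Xd Xop]]]] := affine_coordinates gd t2.
case: (gd) => gc dc sgd _ _ [ps [F [psp Fp rl]]].
have K i (o : {ffun 'I_(ar i) -> car}) z : {kz : 'F_p * ('I_(ar i) -> option Z) |
    forall v, (forall k, d (o k) (v k)) ->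
    X z (fops v) = (kz.1 + \sum_k oapp (fun z' => X z' (v k)) 0 (kz.2 k))%R}.
  by apply: cid; have [ka [zk H]] := Xop i o z; exists (ka, zk).
have gE x y : g x y = d x y && [forall z, X z x == X z y].
  apply/idP/andP => [gxy|[dxy /forallP Xxy]].
    by split; [apply: sgd|apply/forallP => z; apply/eqP/Xg].
  by apply: Xd => // z; apply/eqP.
pose q1 := (\sum_i ar i).*2 + 3.
pose K1 := #|car| + 1 + #|op_instance|.
pose K2 := #|car| + 1 + #|Z| * #|{: 'F_p}|.
pose F' N := F N + (N * K1) * q1 + (N * K2) * ((N * #|Z|) * (edge_bound p).+1 + 3)
  + (N * (#|car| + 1)) * (#|Z|.*2 + 3).
exists [:: p, p, p & ps], F'; split; first by rewrite /= pp psp.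
  rewrite /F'; do !(apply: polybound_add || apply: polybound_mul);
    rewrite //; by [exact: polybound_id | exact: polybound_cst].
move=> n c n0 s0 wfc.
have r1 := joint_layer (Ordinal s0) pp (rl n c n0 s0 wfc).
have r2 := coord_layer (Ordinal n0) dc pp wfc (fun i o z => svalP (K i o z)) r1.
have r3 := refine_layer pp gE r2.
apply: layers_weaken r3; rewrite /F'.
have cw : #|wires n c| <= (n + size c) * (#|car| + 1).
  by rewrite card_sum card_prod !card_ord; lia.
have cj : #|joint_wires n c| <= (n + size c) * K1.
  by rewrite card_sum card_prod !card_ord /K1; nia.
have cc : #|coord_wires p Z n c| <= (n + size c) * K2.
  rewrite card_sum card_prod card_prod [#|'I_(size c)|]card_ord /K2 mulnDr leq_add //.
  by rewrite -mulnA leq_mul2r leq_addl orbT.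
by rewrite !leq_add // leq_mul // leq_add // leq_mul // leq_mul // leq_addl.
Qed.
End Levels.

(** * The classes modulo [beta] and the descent to equality *)

Section Containment.
Variables (I : finType) (ar : I -> nat) (A : finAlg ar) (io : bool -> fcar A).
Notation car := (fcar A).

(* Each order on a subdirect factor is used or reversed so that [io] is monotone. *)
Lemma subdirect_orders (th : rel car) : is_con A th -> subdirect_tot (quot A th) ->
  exists le : car * car -> rel car,
    [/\ forall q, reflexive (le q), forall q, transitive (le q),
        forall q i (x y : 'I_(ar i) -> car), (forall k, le q (x k) (y k)) ->
          le q (fops x) (fops y),
        forall q, le q (io false) (io true) &
        forall x y, th x y <-> forall q, le q x y /\ le q y x].
Proof.
move=> [tr ts tt tops] [J [B [h [Btot [hinj [hhom _]]]]]].
pose pr x : fcar (quot A th) := qproj th x.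
have prE x y : th x y -> pr x = pr y.
  move=> xy; apply: val_inj; apply/setP => z; rewrite !inE.
  by apply/idP/idP; apply: tt; rewrite // ts.
have prI x y : pr x = pr y -> th x y.
  by move=> /(congr1 val) /setP /(_ y); rewrite !inE tr.
have repE x : th x (qrep (pr x)).
  have := xchooseP (elimT existsP (valP (pr x))) => /eqP /setP /(_ (qrep (pr x))).
  by rewrite !inE /= /qrep tr.
have prop i (x : 'I_(ar i) -> car) j :
    h (pr (fops x)) j = @aops _ _ (B j) i (fun k => h (pr (x k)) j).
  by rewrite -hhom; congr (h _ j); apply: prE; apply: tops => k.
(* One preorder per pair: the pullback of the order of a factor separating the pair, or the full
   relation if the pair is in [th]. This leaves finitely many preorders whatever the index type
   [J]. *)
have /choice[le leP] : forall q : car * car, exists le : rel car,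
    [/\ reflexive le, transitive le,
        forall i (x y : 'I_(ar i) -> car), (forall k, le (x k) (y k)) -> le (fops x) (fops y),
        le (io false) (io true) &
        (forall x y, th x y -> le x y) /\ (le q.1 q.2 -> le q.2 q.1 -> th q.1 q.2)].
  move=> [a b].
  have [tab|ntab] := boolP (th a b); first by exists (fun _ _ => true).
  have [j hj] : exists j, h (pr a) j <> h (pr b) j.
    apply: contrapT => nj; move: ntab; rewrite prI //; apply: hinj => j.
    by apply: contrapT => hj; apply: nj; exists j.
  have [lej [lr [la [lt [ll lo]]]]] := Btot j.
  have [ori|ori] := ll (h (pr (io false)) j) (h (pr (io true)) j).
    exists (fun x y => `[<lej (h (pr x) j) (h (pr y) j)>]); split.
    - by move=> x; apply/asboolP.
    - by move=> y x z /asboolP xy /asboolP yz; apply/asboolP; apply: lt yz.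
    - by move=> i x y xy; apply/asboolP; rewrite !prop; apply: lo => k; apply/asboolP.
    - exact/asboolP.
    - split=> [x y xy|/asboolP l1 /asboolP l2]; last by case: hj; apply: la.
      by apply/asboolP; rewrite (prE _ _ xy).
  exists (fun x y => `[<lej (h (pr y) j) (h (pr x) j)>]); split.
  - by move=> x; apply/asboolP.
  - by move=> y x z /asboolP xy /asboolP yz; apply/asboolP; apply: lt xy.
  - by move=> i x y xy; apply/asboolP; rewrite !prop; apply: lo => k; apply/asboolP.
  - exact/asboolP.
  - split=> [x y xy|/asboolP l1 /asboolP l2]; last by case: hj; apply: la.
    by apply/asboolP; rewrite (prE _ _ xy).
exists le; split=> [q|q|q|q|x y]; try by have [] := leP q.
split=> [xy q|H]; first by have [_ _ _ _ [tl _]] := leP q; rewrite !tl // ts.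
by have [_ _ _ _ [_ sep]] := leP (x, y); have [h1 h2] := H (x, y); apply: sep.
Qed.

(** A value is in the class of [a] iff both have the same thresholds. Testing equality also requires
    negated thresholds, so a layer over GF(2) first provides both polarities. *)
Lemma layered_subdirect (th : rel car) :
  is_con A th -> subdirect_tot (quot A th) -> layered io th.
Proof.
move=> thc /(subdirect_orders thc) [le [lr lt lo li lth]].
pose J : finType := (car * car)%type; pose JA : finType := (J * car)%type.
pose KA := #|JA| * threshold_gates A.
pose q3 := #|JA|.*2 + 3.
pose F N := 3 * (3 * N + N * KA) + (N * (#|JA| + 1)) * 3 + (N * (#|JA| + 1) * 2) * 3
  + (N * (#|car| + 1)) * q3.
exists [:: 2; 2; 2], F; split=> //.
  rewrite /F; do !(apply: polybound_add || apply: polybound_mul);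
    rewrite //; by [exact: polybound_id | exact: polybound_cst].
move=> n c n0 s0 wfc.
have [mc [pos [mwf [nm sm] posm mv]]] := mono_thresholds lr lt lo li n0 wfc.
pose T0 : finType := ('I_(size c) * JA + 'I_n)%type.
pose pos0 (t : T0) := match t with inl (m, q) => pos (val m) q | inr j => val j end.
pose Spec0 (x : nat -> bool) (y : T0 -> bool) := (forall j, y (inr j) = x j) /\
  (mixed_input n x -> forall m q, y (inl (m, q)) = le q.1 q.2 (node_value io c x m)).
have r0 : @layers_realize n [:: 2] T0 Spec0 (msize mc + #|T0| * 3).
  apply: (layers_base mwf (pos := pos0)).
    by case=> [[m q]|j] /=; [apply: posm|apply: leq_trans nm].
  move=> x; have [vi vm] := mv x; split=> [j|ok m q] /=; first by rewrite vi.
  by rewrite vm.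
pose Spec1 (x : nat -> bool) (y : (T0 * bool)%type -> bool) := exists2 y0, Spec0 x y0 &
  forall t b, y (t, b) = (y0 t == b).
have r1 : @layers_realize n [:: 2; 2] (T0 * bool)%type Spec1
    (msize mc + #|T0| * 3 + #|{: T0 * bool}| * 3).
  apply: (layers_step (R := fun t Y b => b = (Y (enum_rank t.1) == t.2)) r0).
    move=> [t b]; have [g [gw gs gv]] := sum_gate [:: t] [set ((b : nat)%:R : 'F_2)%R].
    exists g; split=> //; first by rewrite gs.
    by move=> Y; rewrite gv big_seq1 inE; case: (Y _); case: b {gv}.
  by move=> x Y y' S0 yE; exists (fun t => Y (enum_rank t)) => // t b; rewrite yE.
pose lits (t : wires n c) : seq (T0 * bool)%type := match t with
  | inl (m, a) => [seq (inl (m, q), le q.1 q.2 a) | q <- enum JA]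
  | inr j => [:: (inr j, true)] end.
have r2 : @layers_realize n [:: 2; 2; 2] (wires n c) (@class_spec _ _ A io n c th)
    (msize mc + #|T0| * 3 + #|{: T0 * bool}| * 3 + #|wires n c| * q3).
  apply: (layers_step (R := fun t Y b => b = all (fun u => Y (enum_rank u)) (lits t)) r1).
    move=> t; have [g [gw gs gv]] := and_gate (p := 2) (lits t) isT.
    exists g; split=> //; apply: leq_trans gs _; rewrite /q3.
    rewrite addnS addn2 ltnS; case: (t) => [[m a]|j]; last by rewrite /=; lia.
    by rewrite size_map -cardE; apply: leqW; apply: leqW.
  move=> x Y y' [y0 [yin ycl] yb] yE; split=> [j|ok m a].
    by rewrite yE /= andbT yb yin; case: (x j).
  rewrite yE /= all_map; apply/allP/idP => [H|va q _] /=.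
    apply/lth => q.
    have e b : le q b (node_value io c x m) = le q b a.
      by have := H (q, b) (mem_enum _ _); rewrite /= yb ycl // => /eqP.
    by split; [rewrite -e; apply: lr|rewrite e; apply: lr].
  rewrite yb ycl //; apply/eqP; have [l1 l2] := iffLR (lth _ _) va q.1.
  by apply/idP/idP => l; apply: lt l _.
apply: layers_weaken r2; rewrite /F.
have cw : #|wires n c| <= (n + size c) * (#|car| + 1).
  by rewrite card_sum card_prod !card_ord; lia.
have c0 : #|T0| <= (n + size c) * (#|JA| + 1).
  by rewrite card_sum card_prod !card_ord; lia.
rewrite card_prod card_bool; apply: leq_add; last by rewrite leq_mul.
apply: leq_add; last by rewrite !leq_mul.
apply: leq_add; last by rewrite leq_mul.
apply: leq_trans (msize_leq _) _; rewrite leq_mul2l /=; apply: leq_trans sm _.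
by rewrite leq_add // ?leq_mul // ?leq_addr ?leq_addl.
Qed.

Lemma is_con_eq : is_con A (fun x y => x == y).
Proof.
split=> [x|x y|y x z /eqP->//|i x y xy]; [exact: eqxx|exact: eq_sym|].
by apply/eqP; congr fops; apply: funext => k; apply/eqP.
Qed.

(** Among the congruences strictly below [th], one with the most pairs is covered by [th]. *)
Lemma lower_cover (th : rel car) x y : is_con A th -> th x y -> x != y ->
  exists g, prime_quot A g th.
Proof.
move=> thc txy nxy.
pose rl (R : {set car * car}) : rel car := fun x y => (x, y) \in R.
pose P (R : {set car * car}) := `[< [/\ is_con A (rl R), subrel (rl R) th & ~ subrel th (rl R)] >].
have rlE (r : rel car) : rl [set z | r z.1 z.2] = r.
  by apply: funext => u; apply: funext => v; rewrite /rl inE.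
pose R0 := [set z : car * car | z.1 == z.2].
have P0 : P R0.
  apply/asboolP; rewrite (rlE (fun x y => x == y)); split; first exact: is_con_eq.
    by move=> u v /eqP->; case: thc.
  by move=> /(_ _ _ txy); apply/negP.
case: (arg_maxnP (fun R : {set car * car} => #|R|) P0) => R /asboolP[Rc Rs Rn] Rmax.
exists (rl R); split=> // g gc Rg gth.
have [tg|ntg] := pselect (subrel th g); [by right|left].
have /Rmax : P [set z | g z.1 z.2] by apply/asboolP; rewrite rlE.
move=> cardle; have /eqP : R == [set z | g z.1 z.2].
  rewrite eqEcard [X in _ && X]cardle andbT; apply/subsetP => -[u v] uv; rewrite inE; exact: Rg.
by move=> -> u v; rewrite rlE.
Qed.

Lemma layered_descend (th : rel car) : is_con A th ->
  (forall g d, prime_quot A g d -> subrel d th -> type2 A g d) ->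
  layered io th -> layered io (fun x y => x == y).
Proof.
have [k] := ubnP #|[set z : car * car | th z.1 z.2]|.
elim: k th => // k IH th; rewrite ltnS => card thc t2 lth.
have [[x [y [txy nxy]]]|triv] := pselect (exists x y, th x y /\ x != y).
  have [g gth] := lower_cover thc txy nxy.
  have [gc _ gs ng _] := gth.
  apply: (IH g) => //.
  - apply: leq_trans card; apply: proper_card; rewrite properE.
    apply/andP; split; first by apply/subsetP => -[u v]; rewrite !inE; apply: gs.
    apply/negP => /subsetP sub; apply: ng => u v uv.
    by have := sub (u, v); rewrite !inE; apply.
  - by move=> h d hd dg; apply: t2 => // u v uv; apply/gs/dg.
  - exact: (layered_prime_step gth (t2 _ _ gth (fun _ _ h => h)) lth).
have -> : (fun x y => x == y) = th :> rel car; last by [].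
apply: funext => x; apply: funext => y; apply/eqP/idP => [->|txy]; first by case: thc.
by apply: contrapT => /eqP nxy; apply: triv; exists x, y.
Qed.
End Containment.

(* On the two constant inputs the layers below are unreliable, so their answers
   [no] and [yes] are hardwired; [o + 2 one + 4 zero] determines the three bits mod 7. *)
Lemma output_layers (I : finType) (ar : I -> nat) (A : finAlg ar) (io : bool -> fcar A)
    n c ps s (S : {set fcar A}) (no yes : bool) (last : 'I_(size c)) : 0 < n ->
  @layers_realize n ps (wires n c) (@class_spec _ _ A io n c (fun x y => x == y)) s ->
  @layers_realize n [:: 7, 2, 2 & ps] unit
    (fun x y => y tt = if [forall j : 'I_n, x j == false] then no
      else if [forall j : 'I_n, x j == true] then yes else node_value io c x last \in S)
    (s + (n * 2).+1 * (#|fcar A| + 3) + 3 * (n.*2 + 3) + 9).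
Proof.
move=> n0 rl.
pose T1 : finType := option ('I_n * bool)%type.
(* On mixed inputs the class bits at [last] are equalities, so at most one summand is 1 and the
   parity decides membership in [S]. *)
pose sumS (Y : nat -> bool) := \sum_(t <- [seq inl (last, a) : wires n c | a <- enum S]) Y (enum_rank t).
pose R1 (t : T1) (Y : nat -> bool) b := match t with
  | None => b = (((sumS Y)%:R)%R \in [set (1 : 'F_2)%R])
  | Some (j, b') => b = (Y (enum_rank (inr j : wires n c)) == b') end.
pose Spec1 (x : nat -> bool) (y : T1 -> bool) := (forall j b, y (Some (j, b)) = (x j == b)) /\
  (mixed_input n x -> y None = (node_value io c x last \in S)).
have r1 : @layers_realize n (2 :: ps) T1 Spec1 (s + (n * 2).+1 * (#|fcar A| + 3)).
  have <- : #|T1| = (n * 2).+1 by rewrite card_option card_prod card_ord card_bool.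
  apply: (layers_step (R := R1) rl) => [[[j b]|]|x Y y' [yin ycl] yE].
  - have [g [gw gs gv]] := sum_gate [:: inr j : wires n c] [set ((b : nat)%:R : 'F_2)%R].
    exists g; split=> //; first by rewrite gs addnC.
    by move=> Y; rewrite /R1 gv big_seq1 inE; case: (Y _); case: b {gv}.
  - have [g [gw gs gv]] := sum_gate [seq inl (last, a) : wires n c | a <- enum S] [set (1 : 'F_2)%R].
    exists g; split=> //; rewrite gs size_map -cardE addn3 ltnS ltnS leqW //.
    exact: max_card.
  split=> [j b|ok]; first by rewrite (yE (Some (j, b))) yin.
  rewrite (yE None) (_ : sumS Y = (node_value io c x last \in S)).
    by case: (_ \in S); rewrite inE.
  rewrite /sumS big_map big_enum /=; under eq_bigr do rewrite ycl //.
  have [VS|VS] := boolP (_ \in S).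
    rewrite (bigD1 (node_value io c x last)) //= eqxx big1 // => a /andP[_ /negbTE].
    by rewrite eq_sym => ->.
  by rewrite big1 // => a aS; case: eqP => // Va; rewrite Va aS in VS.
pose Spec2 (x : nat -> bool) (y : option bool -> bool) :=
  (forall b, y (Some b) = [forall j : 'I_n, x j == b]) /\
  (mixed_input n x -> y None = (node_value io c x last \in S)).
pose lits (t : option bool) : seq T1 := if t is Some b then
  [seq Some (j, b) | j <- enum 'I_n] else [:: None].
have r2 : @layers_realize n [:: 2, 2 & ps] (option bool) Spec2
   (s + (n * 2).+1 * (#|fcar A| + 3) + #|{: option bool}| * (n.*2 + 3)).
  apply: (layers_step (R := fun t Y b => b = all (fun u => Y (enum_rank u)) (lits t)) r1).
    move=> t; have [g [gw gs gv]] := and_gate (p := 2) (lits t) isT.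
    exists g; split=> //; apply: leq_trans gs _.
    case: (t) => [b|] /=; last by rewrite leq_addl.
    by rewrite size_map size_enum_ord addnS ltnS leq_addr.
  move=> x Y y' [yin yo] yE; split=> [b|ok]; last by rewrite yE /= andbT yo.
  rewrite yE /= all_map; apply/allP/forallP => H j; first by have := H j (mem_enum _ _); rewrite /= yin.
  by move=> _ /=; rewrite yin.
rewrite card_option card_bool in r2.
pose sum3 (Y : nat -> bool) (l : seq (option bool)) := \sum_(t <- l) Y (enum_rank t).
pose l3 : seq (option bool) := [:: None; Some true; Some true; Some false; Some false; Some false; Some false].
(* The sum is 0 or 1 on mixed inputs, 2 or 3 on the all-one word, 4 or 5 on the all-zero word; as
   [n] is positive, a word cannot be both. *)
pose tgt : {set 'F_7} := [set v : 'F_7 |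
  [|| (v : nat) == 1, yes && ((v : nat) \in [:: 2; 3]) | no && ((v : nat) \in [:: 4; 5])]].
have := layers_step (q := 9) (p := 7) (T' := unit)
  (R := fun t Y b => b = (((sum3 Y l3)%:R)%R \in tgt)) r2.
rewrite card_unit mul1n; apply.
  move=> t; have [g [gw gs gv]] := sum_gate l3 tgt.
  by exists g; split=> //; rewrite gs.
move=> x Y y' [yb yo] yE; rewrite yE /sum3 /l3 unlock /= !yb.
have [/forallP z|nz] := boolP [forall j : 'I_n, x j == false].
  have -> : [forall j : 'I_n, x j == true] = false.
    apply/negbTE/forallPn; exists (Ordinal n0); by rewrite (eqP (z (Ordinal n0))).
  by rewrite inE; case: (Y _); case: (no); case: (yes).
have [/forallP z|nz'] := boolP [forall j : 'I_n, x j == true].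
  by rewrite inE; case: (Y _); case: (no); case: (yes).
rewrite yo; first by rewrite inE; case: (_ \in S); case: (no); case: (yes).
split.
  by have /forallPn[j xj] := nz; exists j => //; case: (x j) xj.
by have /forallPn[j xj] := nz'; exists j => //; case: (x j) xj.
Qed.

Lemma eq_nseq_nth n v (b : seq bool) : size b = n ->
  [forall j : 'I_n, nth false b j == v] -> b = nseq n v.
Proof.
move=> sb /forallP H; apply: (@eq_from_nth _ false); first by rewrite size_nseq.
by move=> i; rewrite sb => ilt; rewrite nth_nseq ilt; apply/eqP/(H (Ordinal ilt)).
Qed.

Theorem nuP_nuItDet (I : finType) (ar : I -> nat) (A : finAlg ar) (beta : rel (fcar A)) :
  is_con A beta ->
  (forall g d, prime_quot A g d -> subrel d beta -> type2 A g d) ->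
  subdirect_tot (quot A beta) ->
  forall L, nuP A L -> nuItDet_MONOTONE L.
Proof.
move=> bc t2 sub L [t [io [S [[k [e tP]] LP]]]].
have [ps [F [psp [eF FP] rl]]] := layered_descend bc t2 (layered_subdirect io bc sub).
exists [:: 7, 2, 2 & ps]; split=> //; split=> //.
pose G n := (n + (k * n ^ e + k) + 2) ^ eF + (n * 2 + 1) * (#|fcar A| + 3) + 3 * (2 * n + 3) + 9.
have CP n : exists C : itcirc [:: 7, 2, 2 & ps], 0 < n ->
    it_wf n C /\ it_size C <= G n /\ forall b, size b = n -> (L b <-> it_accepts C b).
  have [n0|n0] := posnP n.
    by exists (@ItCirc [:: 7, 2, 2 & ps] [::] (fun=> [::])); rewrite n0.
  have [[s0 cwf] cs] := tP n n0.
  have lst : (size (t n)).-1 < size (t n) by rewrite prednK.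
  have [C [[Cm _] C0 Cl Cs Cv]] := output_layers S (nudfa_accepts t io S (nseq n false))
    (nudfa_accepts t io S (nseq n true)) (Ordinal lst) n0 (rl n (t n) n0 s0 cwf).
  exists C => _; split; first by split=> //; rewrite C0 card_unit.
  split.
    apply: leq_trans Cs _; rewrite /G addn2 addn1 mul2n !leq_add2r; apply: leq_trans (FP _) _.
    case: (eF) => // e'; rewrite leq_exp2r // !ltnS leq_add2l.
    by apply: leq_trans cs; rewrite /circ_size leq_addr.
  move=> b sb; rewrite LP ?sb // /it_accepts.
  have := Cv (fun j => nth false b j); rewrite [X in nth _ _ X](_ : _ = 0); last first.
    have : enum_rank tt < 1 by rewrite -[X in _ < X]card_unit ltn_ord.
    by case: (enum_rank tt : nat).
  move=> ->; have [/(eq_nseq_nth sb) ->|_] := boolP [forall j : 'I_n, nth false b j == false] => //.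
  have [/(eq_nseq_nth sb) ->|_] := boolP [forall j : 'I_n, nth false b j == true] => //.
  by rewrite -cout_node_value // /nudfa_accepts sb.
have [C CC] := choice CP.
have [c' [e' Ge]] : exists c e, forall n, 0 < n -> G n <= c * n ^ e + c.
  apply: polybound_std; rewrite /G.
  by repeat first [exact: polybound_cst | exact: polybound_id | apply: polybound_add
    | apply: polybound_mul | apply: polybound_exp].
exists C, c', e' => n n0; have [w [s a]] := CC n n0.
by split=> //; split=> //; apply: leq_trans s (Ge n n0).
Qed.

(** * Branching programs as powers of the adjacency matrix *)

Section AbpMatrix.
Variables (p m N : nat) (g : babp p) (y : nat -> bool).
Hypothesis gwf : babp_wf m g.
Hypothesis gN : bnv g <= N.+1.
Local Notation E := (bedges g).

Definition abp_val k : 'F_p := nth 0%R (abp_vals E y k.+1) k.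
(** The dimension [N.+1] is shared by all gates of a layer; numbers from [bnv g] on are isolated
    vertices. *)
Definition abp_adj : 'M['F_p]_N.+1 :=
  (\matrix_(i, j) \sum_(e <- E | (e.1.1 == i) && (e.1.2 == j)) alab_val y e.2)%R.
Definition abp_sink : 'I_N.+1 := inord (bnv g).-1.
Definition abp_loop : 'M['F_p]_N.+1 := (abp_adj + delta_mx abp_sink abp_sink)%R.

Lemma size_abp_vals k : size (abp_vals E y k) = k.
Proof. by elim: k => //= k IH; rewrite size_rcons IH. Qed.

Lemma nth_abp_vals k i : i < k -> nth 0%R (abp_vals E y k) i = abp_val i.
Proof.
elim: k => // k IH; rewrite ltnS leq_eqVlt => /orP[/eqP->//|ik].
by rewrite [abp_vals _ _ _]/= nth_rcons size_abp_vals ik IH.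
Qed.

Lemma edges_wf : all (fun e => (e.1.1 < e.1.2) && (e.1.2 < bnv g)) E.
Proof. by move: gwf => /andP[_]; apply: sub_all => e /andP[]. Qed.

Lemma abp_val0 : abp_val 0 = 1%R.
Proof. by []. Qed.

Lemma abp_valS k : 0 < k ->
  abp_val k = (\sum_(e <- E | e.1.2 == k) abp_val e.1.1 * alab_val y e.2)%R.
Proof.
move=> k0; rewrite {1}/abp_val [abp_vals _ _ _]/= nth_rcons size_abp_vals ltnn eqxx.
rewrite gtn_eqF //; apply: (eq_big_all _ _ edges_wf) => e /andP[elt _] /eqP ek.
by rewrite nth_abp_vals // -ek.
Qed.

Lemma babp_valueE : babp_value g y = abp_val (bnv g).-1.
Proof. by rewrite /babp_value nth_abp_vals //; case/andP: gwf => g0 _; rewrite prednK. Qed.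

Lemma sink_val : abp_sink = (bnv g).-1 :> nat.
Proof. by rewrite inordK //; case/andP: gwf => g0 _; rewrite prednK. Qed.

Lemma abp_adj0 (i j : 'I_N.+1) : (j <= i) || (bnv g <= j) -> abp_adj i j = 0%R.
Proof.
move=> ij; rewrite mxE; elim: E edges_wf => [|e l IH] /=; first by rewrite big_nil.
move=> /andP[/andP[e1 e2] /IH]; rewrite big_cons.
by case: ifP => // /andP[/eqP a /eqP b]; move: ij; rewrite leqNgt -a -b e1 /= leqNgt e2.
Qed.

(** Each edge raises the vertex number, so the adjacency matrix is strictly triangular and
    nilpotent. *)
Lemma abp_adj_expr0 K (i j : 'I_N.+1) : j < i + K -> (abp_adj ^+ K)%R i j = 0%R.
Proof.
elim: K j => [|K IH] j; first by rewrite addn0 expr0 mxE => ji; rewrite -val_eqE gtn_eqF.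
move=> jK; rewrite exprSr mxE big1 // => k _.
have [kj|jk] := ltnP k j; last by rewrite abp_adj0 ?jk ?mulr0.
by rewrite IH ?mul0r //; lia.
Qed.

Definition abp_row : 'rV['F_p]_N.+1 :=
  (\row_j if (j < bnv g)%N then abp_val j else 0)%R.

(** The vertex recurrence in matrix form; iterating it expresses the values through powers of the
    adjacency matrix. *)
Lemma abp_rowE : (abp_row = delta_mx ord0 ord0 + abp_row *m abp_adj)%R.
Proof.
apply/rowP => j; rewrite !mxE.
have -> : (\sum_i abp_row ord0 i * abp_adj i j = \sum_(e <- E | e.1.2 == j) abp_val e.1.1 * alab_val y e.2)%R.
  under eq_bigr => i _ do rewrite [abp_adj i j]mxE.
  elim: E edges_wf => [|e l IH] /=.
    by rewrite big_nil big1 // => i _; rewrite big_nil mulr0.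
  move=> /andP[/andP[e1 e2] /IH lE]; rewrite big_cons -lE.
  have srcN : e.1.1 < N.+1 by apply: leq_trans gN; apply: ltn_trans e2.
  rewrite (bigD1 (Ordinal srcN)) //= [in RHS](bigD1 (Ordinal srcN)) //=.
  rewrite (eq_bigr (fun i => abp_row ord0 i * \sum_(e <- l | (e.1.1 == i) && (e.1.2 == j)) alab_val y e.2)%R); last first.
    move=> i; rewrite -val_eqE /= => ni; rewrite big_cons (_ : (e.1.1 == i) = false) //.
    by rewrite eq_sym; apply/negbTE.
  rewrite big_cons eqxx /=; case: ifP => // _; rewrite mulrDr -addrA; congr (_ * _ + _)%R.
  by rewrite mxE /= (ltn_trans e1 e2).
rewrite eqxx /=; have [jn|nj] := ltnP j (bnv g); last first.
  rewrite (_ : j == ord0 = false) ?add0r; last first.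
    apply: gtn_eqF; apply: leq_trans nj; by case/andP: gwf.
  elim: E edges_wf => [|e l IH] /=; first by rewrite big_nil.
  move=> /andP[/andP[e1 e2] /IH lE]; rewrite big_cons -lE.
  by case: eqP => // ej; move: e2; rewrite ej ltnNge nj.
have [j0|j0] := posnP j.
  rewrite (_ : j = ord0) ?eqxx; last exact: val_inj.
  rewrite abp_val0 (_ : \sum_(e <- E | _) _ = 0)%R ?addr0 //.
  elim: E edges_wf => [|e l IH] /=; first by rewrite big_nil.
  move=> /andP[/andP[e1 e2] /IH lE]; rewrite big_cons lE.
  by case: eqP => // ej; move: e1; rewrite ej.
by rewrite -val_eqE gtn_eqF // add0r abp_valS.
Qed.

Lemma abp_row_expr K : (abp_row = \sum_(k < K) delta_mx ord0 ord0 *m abp_adj ^+ k + abp_row *m abp_adj ^+ K)%R.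
Proof.
elim: K => [|K IH]; first by rewrite big_ord0 add0r expr0 mulmx1.
rewrite {1}IH big_ord_recr /= -addrA; congr (_ + _)%R.
rewrite {1}abp_rowE mulmxDl; congr (_ + _)%R.
by rewrite -mulmxA exprS.
Qed.

(* The loop at the sink accumulates the contributions of all path lengths. *)
Lemma abp_loop_expr K j : (abp_loop ^+ K)%R ord0 j =
  if j == abp_sink then (\sum_(k < K.+1) (abp_adj ^+ k) ord0 abp_sink)%R
  else (abp_adj ^+ K)%R ord0 j.
Proof.
elim: K j => [|K IH] j.
  by rewrite big_ord1 !expr0; case: eqP => // ->.
(* No edge leaves the sink, the last vertex, so the loop is the only nonzero entry of its row. *)
have rows i : (abp_adj abp_sink i = 0)%R.
  rewrite abp_adj0 // sink_val; have [|] := ltnP i (bnv g); last by rewrite orbT.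
  by case: (bnv g) => // k; rewrite ltnS => ->.
rewrite exprSr mxE (bigD1 abp_sink) //= IH eqxx.
rewrite (eq_bigr (fun i => (abp_adj ^+ K)%R ord0 i * abp_adj i j)%R); last first.
  move=> i ni; rewrite IH (negbTE ni); congr (_ * _)%R.
  by rewrite !mxE (negbTE ni) addr0.
have -> : abp_loop abp_sink j = ((j == abp_sink)%:R)%R.
  by rewrite /abp_loop mxE rows add0r mxE eqxx.
have -> : (\sum_(i | i != abp_sink) (abp_adj ^+ K) ord0 i * abp_adj i j)%R = ((abp_adj ^+ K.+1) ord0 j)%R.
  by rewrite exprSr mxE [in RHS](bigD1 abp_sink) //= rows mulr0 add0r.
case: eqP => [->|_]; last by rewrite mulr0 add0r.
by rewrite mulr1 [in RHS]big_ord_recr.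
Qed.

(** Every exponent above [N] gives the same entry, so it can be a power of two and be reached by
    squaring. *)
Lemma abp_loop_value K : N < K -> (abp_loop ^+ K)%R ord0 abp_sink = babp_value g y.
Proof.
move=> NK; rewrite abp_loop_expr eqxx big_ord_recr /= abp_adj_expr0 ?addr0; last first.
  by rewrite add0n; apply: leq_trans NK.
rewrite babp_valueE; have := abp_row_expr K; move/rowP/(_ abp_sink).
rewrite [X in (_ *m X)%R](_ : _ = 0)%R; last first.
  apply/matrixP => i j; rewrite abp_adj_expr0 ?mxE //.
  by apply: leq_trans (leq_addl _ _); apply: leq_trans NK.
rewrite mulmx0 addr0 mxE sink_val; have -> : (bnv g).-1 < bnv g.
  by case/andP: gwf => g0 _; rewrite prednK.
move=> ->; rewrite summxE; apply: eq_bigr => k _.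
by rewrite -rowE mxE.
Qed.
End AbpMatrix.

(** * Shallow circuits on top of a monotone circuit *)

Inductive nform (T : Type) := FLeaf of T | FCst of bool | FNot of nform T
  | FAnd of nform T & nform T | FOr of nform T & nform T.
Arguments FCst {T} b.

Fixpoint feval T (v : T -> bool) f := match f with
  | FLeaf t => v t | FCst b => b | FNot f => ~~ feval v f
  | FAnd f g => feval v f && feval v g | FOr f g => feval v f || feval v g end.
(* Constants are compiled to [l && ~~ l] or [l || ~~ l], hence their cost. *)
Fixpoint fsize T (f : nform T) := match f with
  | FLeaf _ => 0 | FCst _ => 3 | FNot f => (fsize f).+1
  | FAnd f g | FOr f g => (fsize f + fsize g).+1 end.
Fixpoint fdepth T (f : nform T) := match f with
  | FLeaf _ => 0 | FCst _ => 2 | FNot f => (fdepth f).+1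
  | FAnd f g | FOr f g => (maxn (fdepth f) (fdepth g)).+1 end.

Definition fbigor T (l : seq (nform T)) := foldr (@FOr T) (FCst false) l.

Lemma feval_bigor T v (l : seq (nform T)) : feval v (fbigor l) = has (feval v) l.
Proof. by elim: l => //= f l ->. Qed.

Lemma fsize_bigor T (l : seq (nform T)) k : all (fun f => fsize f <= k) l ->
  fsize (fbigor l) <= size l * k.+1 + 3.
Proof. by elim: l => //= f l IH /andP[fk /IH]; rewrite mulSn; lia. Qed.

Lemma fdepth_bigor T (l : seq (nform T)) k : all (fun f => fdepth f <= k) l ->
  fdepth (fbigor l) <= size l + maxn k 2.
Proof. by elim: l => [|f l IH] /=; [lia|move=> /andP[fk /IH]; lia]. Qed.

Lemma nvals_rcons ms c nd : nvals ms (rcons c nd) = rcons (nvals ms c) (nnode_val ms (nvals ms c) nd).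
Proof. by rewrite /nvals -cats1 foldl_cat. Qed.
Lemma ndepths_rcons c nd : ndepths (rcons c nd) = rcons (ndepths c) (nnode_depth (ndepths c) nd).
Proof. by rewrite /ndepths -cats1 foldl_cat. Qed.
Lemma size_nvals ms c : size (nvals ms c) = size c.
Proof. by elim/last_ind: c => // c nd IH; rewrite nvals_rcons !size_rcons IH. Qed.
Lemma size_ndepths c : size (ndepths c) = size c.
Proof. by elim/last_ind: c => // c nd IH; rewrite ndepths_rcons !size_rcons IH. Qed.

Lemma nth_nvals_cat ms c d i : i < size c ->
  nth false (nvals ms (c ++ d)) i = nth false (nvals ms c) i.
Proof.
move=> ic; elim/last_ind: d => [|d nd IH]; first by rewrite cats0.
by rewrite -rcons_cat nvals_rcons nth_rcons size_nvals size_cat ltn_addr.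
Qed.
Lemma nth_ndepths_cat c d i : i < size c ->
  nth 0 (ndepths (c ++ d)) i = nth 0 (ndepths c) i.
Proof.
move=> ic; elim/last_ind: d => [|d nd IH]; first by rewrite cats0.
by rewrite -rcons_cat ndepths_rcons nth_rcons size_ndepths size_cat ltn_addr.
Qed.
Lemma nth_nvals_last ms c nd :
  nth false (nvals ms (rcons c nd)) (size c) = nnode_val ms (nvals ms c) nd.
Proof. by rewrite nvals_rcons nth_rcons size_nvals ltnn eqxx. Qed.
Lemma nth_ndepths_last c nd :
  nth 0 (ndepths (rcons c nd)) (size c) = nnode_depth (ndepths c) nd.
Proof. by rewrite ndepths_rcons nth_rcons size_ndepths ltnn eqxx. Qed.

Definition ngates_wf m c := forall k, k < size c -> nnode_wf m k (nth (NLeaf 0) c k).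

Lemma ngates_wf_rcons m c nd :
  ngates_wf m c -> nnode_wf m (size c) nd -> ngates_wf m (rcons c nd).
Proof.
move=> wfc wfd k; rewrite size_rcons ltnS nth_rcons => kc.
by case: ltngtP kc => // [kc _|->//]; apply: wfc.
Qed.

Section Shallow.
Variables (X : Type) (env : X -> seq bool).

Definition ncomputes m (c0 : seq nnode) (h : X -> bool) s D :=
  exists d p, [/\ ngates_wf m (c0 ++ d), size d <= s, p < size (c0 ++ d),
    nth 0 (ndepths (c0 ++ d)) p <= D &
    forall x, nth false (nvals (env x) (c0 ++ d)) p = h x].

Lemma nc_formula m c (T : Type) (pos : T -> nat) D (g : X -> T -> bool) f : 0 < m ->
  ngates_wf m c -> (forall t, pos t < size c) ->
  (forall t, nth 0 (ndepths c) (pos t) <= D) ->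
  (forall x t, nth false (nvals (env x) c) (pos t) = g x t) ->
  ncomputes m c (fun x => feval (g x) f) (fsize f) (D + fdepth f).
Proof.
move=> m0; pose P f := forall c, ngates_wf m c -> (forall t, pos t < size c) ->
  (forall t, nth 0 (ndepths c) (pos t) <= D) ->
  (forall x t, nth false (nvals (env x) c) (pos t) = g x t) ->
  ncomputes m c (fun x => feval (g x) f) (fsize f) (D + fdepth f).
have bin (nd : nat -> nat -> nnode) (op : bool -> bool -> bool) f1 f2 :
    (forall k a b, a < k -> b < k -> nnode_wf m k (nd a b)) ->
    (forall ds a b, nnode_depth ds (nd a b) = (maxn (nth 0 ds a) (nth 0 ds b)).+1) ->
    (forall ms vs a b, nnode_val ms vs (nd a b) = op (nth false vs a) (nth false vs b)) ->
    P f1 -> P f2 -> forall c, ngates_wf m c -> (forall t, pos t < size c) ->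
    (forall t, nth 0 (ndepths c) (pos t) <= D) ->
    (forall x t, nth false (nvals (env x) c) (pos t) = g x t) ->
    ncomputes m c (fun x => op (feval (g x) f1) (feval (g x) f2))
      (fsize f1 + fsize f2).+1 (D + (maxn (fdepth f1) (fdepth f2)).+1).
  move=> ndwf ndd ndv IH1 IH2 {}c wfc pc pd pv.
  have [d1 [p1 [w1 s1 l1 dp1 v1]]] := IH1 c wfc pc pd pv.
  have [|||d2 [p2 [w2 s2 l2 dp2 v2]]] := IH2 (c ++ d1) w1.
  + by move=> t; rewrite size_cat ltn_addr.
  + by move=> t; rewrite nth_ndepths_cat.
  + by move=> x t; rewrite nth_nvals_cat.
  have l1' : p1 < size ((c ++ d1) ++ d2) by rewrite size_cat ltn_addr.
  exists (d1 ++ rcons d2 (nd p1 p2)), (size ((c ++ d1) ++ d2)).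
  rewrite catA -rcons_cat; split.
  + by apply: ngates_wf_rcons => //; apply: ndwf.
  + by rewrite size_cat size_rcons addnS ltnS leq_add.
  + by rewrite size_rcons.
  + rewrite nth_ndepths_last ndd addnS ltnS nth_ndepths_cat // geq_max.
    rewrite (leq_trans dp1) ?leq_add2l ?leq_maxl //.
    by rewrite (leq_trans dp2) ?leq_add2l ?leq_maxr.
  by move=> x; rewrite nth_nvals_last ndv nth_nvals_cat // v1 v2.
move: c; rewrite -/(P f); elim: f => [t|b|f IH|f1 IH1 f2 IH2|f1 IH1 f2 IH2] c wfc pc pd pv.
- by exists [::], (pos t); rewrite cats0 /= addn0; split.
- pose k := size c; pose nd := if b then NOr k k.+1 else NAnd k k.+1.
  pose c1 := rcons c (NLeaf 0); pose c2 := rcons c1 (NNot k).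
  have s1 : size c1 = k.+1 by rewrite size_rcons.
  have s2 : size c2 = k.+2 by rewrite size_rcons s1.
  have w1 : ngates_wf m c1 by apply: ngates_wf_rcons.
  have w2 : ngates_wf m c2 by apply: ngates_wf_rcons => //=; rewrite s1.
  have e12 : c2 = c1 ++ [:: NNot k] by rewrite cats1.
  have -> : ncomputes m c (fun x => feval (g x) (FCst b)) (fsize (@FCst T b)) (D + 2) =
            ncomputes m c (fun=> b) 3 (D + 2) by [].
  exists [:: NLeaf 0; NNot k; nd], k.+2.
  have -> : c ++ [:: NLeaf 0; NNot k; nd] = rcons c2 nd by rewrite /c2 /c1 -!cats1 -!catA.
  split=> //.
  + apply: ngates_wf_rcons => //; rewrite s2 /nd; case: b nd => nd /=; by rewrite !ltnS leqnn ltnW.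
  + by rewrite size_rcons s2.
  + rewrite -s2 nth_ndepths_last.
    have d0 : nth 0 (ndepths c2) k = 0.
      by rewrite e12 nth_ndepths_cat ?s1 // nth_ndepths_last.
    have d1 : nth 0 (ndepths c2) k.+1 = 1.
      by rewrite -s1 nth_ndepths_last /= nth_ndepths_last.
    by rewrite /nd; case: (b); rewrite /= d0 d1 leq_addl.
  move=> x; rewrite -s2 nth_nvals_last.
  have v0 : nth false (nvals (env x) c2) k = nth false (env x) 0.
    by rewrite e12 nth_nvals_cat ?s1 // nth_nvals_last.
  have v1 : nth false (nvals (env x) c2) k.+1 = ~~ nth false (env x) 0.
    by rewrite -s1 nth_nvals_last /= nth_nvals_last.
  by rewrite /nd; case: (b); rewrite /= v0 v1 ?orbN ?andbN.
- have [d [p [wd sd lp dp vp]]] := IH c wfc pc pd pv.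
  exists (rcons d (NNot p)), (size (c ++ d)); rewrite -rcons_cat; split.
  + exact: ngates_wf_rcons.
  + by rewrite size_rcons ltnS.
  + by rewrite size_rcons.
  + by rewrite nth_ndepths_last /= addnS ltnS.
  by move=> x; rewrite nth_nvals_last /= vp.
- by apply: (bin NAnd andb) => // k a b /= -> ->.
- by apply: (bin NOr orb) => // k a b /= -> ->.
Qed.

Variable m : nat.
Hypothesis m0 : 0 < m.

Definition nc_realize (T : Type) (g : X -> T -> bool) D s :=
  exists c pos, [/\ ngates_wf m c, size c <= s,
    forall t : T, pos t < size c, forall t, nth 0 (ndepths c) (pos t) <= D &
    forall x t, nth false (nvals (env x) c) (pos t) = g x t].

Lemma nc_reindex T T' (a : T' -> T) g D s :
  nc_realize g D s -> nc_realize (fun x t' => g x (a t')) D s.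
Proof. by move=> [c [pos [h1 h2 h3 h4 h5]]]; exists c, (pos \o a); split=> //= ? ?; rewrite h5. Qed.

(** The formulas stand side by side on the same outputs: their sizes add up, while the depth grows
    by that of one formula. *)
Lemma nc_step (T : Type) (T' : finType) g D s q dd (F : T' -> nform T) :
  nc_realize g D s -> (forall t', fsize (F t') <= q /\ fdepth (F t') <= dd) ->
  nc_realize (fun x t' => feval (g x) (F t')) (D + dd) (s + #|T'| * q).
Proof.
move=> [c [pos [wfc sc pc pd pv]]] FP.
have [d [pos' [wd sd pd' dd' vd]]] : exists d pos', [/\ ngates_wf m (c ++ d),
    size d <= size (enum T') * q,
    forall t, t \in enum T' -> pos' t < size (c ++ d),
    forall t, t \in enum T' -> nth 0 (ndepths (c ++ d)) (pos' t) <= D + dd &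
    forall x t, t \in enum T' -> nth false (nvals (env x) (c ++ d)) (pos' t) = feval (g x) (F t)].
  elim: (enum T') => [|t l [d [pos' [wd sd pd' dd' vd]]]].
    by exists [::], (fun=> 0); rewrite cats0.
  have [|||d2 [p [w2 s2 l2 dp v2]]] := @nc_formula m (c ++ d) T pos D g (F t) m0 wd.
  - by move=> u; rewrite size_cat ltn_addr.
  - by move=> u; rewrite nth_ndepths_cat.
  - by move=> x u; rewrite nth_nvals_cat.
  have [Fs Fd] := FP t.
  exists (d ++ d2), (fun u => if u == t then p else pos' u); rewrite catA; split=> //.
  - by rewrite /= mulSn addnC size_cat leq_add // (leq_trans s2).
  - move=> u; rewrite inE; case: eqP => //= _ ul.
    by rewrite size_cat ltn_addr // pd'.
  - move=> u; rewrite inE; case: eqP => [_ _|_] /=.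
      by rewrite (leq_trans dp) // leq_add2l.
    by move=> ul; rewrite nth_ndepths_cat ?dd' ?pd'.
  - move=> x u; rewrite inE; case: eqP => [->|_] //= ul.
    by rewrite nth_nvals_cat ?vd ?pd'.
exists (c ++ d), pos'; split=> // [|t|t|x t].
- by rewrite size_cat leq_add // cardE.
- by rewrite pd' ?mem_enum.
- by rewrite dd' ?mem_enum.
- by rewrite vd ?mem_enum.
Qed.

Lemma nc_weaken T (g g' : X -> T -> bool) D s D' s' : (forall x t, g x t = g' x t) ->
  D <= D' -> s <= s' -> nc_realize g D s -> nc_realize g' D' s'.
Proof.
move=> gg DD ss [c [pos [h1 h2 h3 h4 h5]]]; exists c, pos; split=> //.
- exact: leq_trans ss.
- by move=> t; apply: leq_trans DD.
- by move=> x t; rewrite h5.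
Qed.
End Shallow.

(** Bounds a disjunction over all pairs of field elements, each costing one conjunction and one
    disjunction; 3 pays for the closing constant. It bounds the depth as well. *)
Definition level_cost p := 2 * #|{: 'F_p * 'F_p}| + 3.

(** * Arithmetic in GF(p) by levels of constant depth *)

Section FieldArrays.
Variables (X : Type) (env : X -> seq bool) (m : nat) (p W D0 s0 : nat).
Hypothesis m0 : 0 < m.

(* Arrays of elements of ['F_p], in one-hot encoding; [l] counts the levels of
   constant depth, each consisting of at most [W] entries. *)
Definition nc_array (T : Type) (h : X -> T -> 'F_p) l :=
  nc_realize env m (fun x (tz : T * 'F_p) => h x tz.1 == tz.2)
    (D0 + l * level_cost p) (s0 + l * (W * #|{: 'F_p}| * level_cost p)).

Lemma nc_array_ext T (h h' : X -> T -> 'F_p) l : (forall x t, h x t = h' x t) ->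
  nc_array h l -> nc_array h' l.
Proof. by move=> hh; apply: nc_weaken => // x t; rewrite hh. Qed.

Lemma nc_level (T : Type) (T' : finType) g (F : T' -> nform T) D s :
  nc_realize env m g D s -> #|T'| <= W * #|{: 'F_p}| ->
  (forall t', fsize (F t') <= level_cost p /\ fdepth (F t') <= level_cost p) ->
  nc_realize env m (fun x t' => feval (g x) (F t')) (D + level_cost p)
    (s + W * #|{: 'F_p}| * level_cost p).
Proof.
move=> rg TW Fc; apply: nc_weaken (nc_step m0 rg Fc) => //.
by rewrite leq_add2l leq_mul2r TW orbT.
Qed.

Lemma nc_array_map2 (T : Type) (T' : finType) (a b : T' -> T) (op : T' -> 'F_p -> 'F_p -> 'F_p)
    (h : X -> T -> 'F_p) l : #|T'| <= W -> nc_array h l ->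
  nc_array (fun x t' => op t' (h x (a t')) (h x (b t'))) l.+1.
Proof.
move=> TW rh.
pose F (tz : T' * 'F_p) := fbigor [seq FAnd (FLeaf (a tz.1, zz.1)) (FLeaf (b tz.1, zz.2)) |
  zz <- enum {: 'F_p * 'F_p} & op tz.1 zz.1 zz.2 == tz.2].
have Fc tz : fsize (F tz) <= level_cost p /\ fdepth (F tz) <= level_cost p.
  have sz : size [seq zz <- enum {: 'F_p * 'F_p} | op tz.1 zz.1 zz.2 == tz.2] <= #|{: 'F_p * 'F_p}|.
    by rewrite size_filter (leq_trans (count_size _ _)) // -cardE.
  rewrite /F /level_cost; split.
    apply: leq_trans (fsize_bigor (k := 1) _) _; first by rewrite all_map; apply/allP.
    by rewrite size_map leq_add2r mulnC leq_mul2l sz.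
  apply: leq_trans (fdepth_bigor (k := 1) _) _; first by rewrite all_map; apply/allP.
  by rewrite size_map; move: sz; lia.
have TF : #|{: T' * 'F_p}| <= W * #|{: 'F_p}| by rewrite card_prod leq_mul.
apply: nc_weaken (nc_level rh TF Fc) => [x [t z]||] /=.
- rewrite /F feval_bigor has_map; apply/hasP/eqP => /= [[[z1 z2]]|<-].
    by rewrite mem_filter => /andP[/eqP /= <- _] /andP[/eqP-> /eqP->].
  exists (h x (a t), h x (b t)); last by rewrite /= !eqxx.
  by rewrite mem_filter /= eqxx mem_enum.
- by rewrite mulSn addnCA addnC.
- by rewrite mulSn addnCA addnC.
Qed.

(** Parallel summation by doubling: after [e] levels, entry [k] holds the sum over a window of
    length [2 ^ e] starting at [k]. After [L] levels the window at 0 covers everything. *)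
Lemma nc_array_sum (T : finType) N L (h : X -> T * 'I_N.+1 -> 'F_p) l :
  #|T| * N.+1 <= W -> N.+1 <= 2 ^ L -> nc_array h l ->
  nc_array (fun x t => \sum_k h x (t, k))%R (l + L.+1).
Proof.
move=> TW NL rh.
pose w e x (tk : T * 'I_N.+1) := (\sum_(j < N.+1 | (tk.2 <= j < tk.2 + 2 ^ e)%N) h x (tk.1, j))%R.
have TNW : #|{: T * 'I_N.+1}| <= W by rewrite card_prod card_ord.
have rw e : nc_array (w e) (l + e).
  elim: e => [|e IH].
    rewrite addn0; apply: nc_array_ext rh => x [t k]; rewrite /w expn0 addn1 /=.
    by rewrite (big_pred1 k) // => j; rewrite ltnS -eqn_leq eq_sym.
  (* If the second half of the window lies beyond [N], it is empty and [z1] is kept; the value of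
     [inord] is then irrelevant. *)
  pose op (tk : T * 'I_N.+1) (z1 z2 : 'F_p) : 'F_p := if tk.2 + 2 ^ e < N.+1 then (z1 + z2)%R else z1.
  have := nc_array_map2 id (fun tk : T * 'I_N.+1 => (tk.1, inord (tk.2 + 2 ^ e))) op TNW IH.
  rewrite addnS; apply: nc_array_ext => x [t k] /=; rewrite /w /op /=.
  rewrite [RHS](bigID (fun j : 'I_N.+1 => j < k + 2 ^ e)) /=.
  have e1 : (\sum_(i < N.+1 | ((k <= i < k + 2 ^ e.+1) && (i < k + 2 ^ e))%N) h x (t, i)
     = \sum_(i < N.+1 | (k <= i < k + 2 ^ e)%N) h x (t, i))%R.
    apply: eq_bigl => i; rewrite expnS; lia.
  rewrite e1; case: ifP => kN.
    congr (_ + _)%R; apply: eq_bigl => i; rewrite inordK // expnS; lia.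
  rewrite [X in (_ = _ + X)%R]big_pred0 ?addr0 // => i; have := ltn_ord i.
  by move: kN; rewrite expnS; lia.
have TW' : #|T| <= W by apply: leq_trans TW; rewrite -{1}[#|T|]muln1 leq_mul2l orbT.
(* One extra level only extracts the window starting at 0. *)
have := nc_array_map2 (fun t => (t, ord0)) (fun t => (t, ord0)) (fun (_ : T) z _ => z) TW' (rw L).
rewrite addnS; apply: nc_array_ext => x t; rewrite /w /=; apply: eq_bigl => j.
by rewrite add0n (leq_trans (ltn_ord j)).
Qed.

Lemma nc_array_of_bits (T : Type) (T' : finType) (a : T' -> option T) (c : T' -> bool -> 'F_p) g :
  #|T'| <= W -> nc_realize env m g D0 s0 ->
  nc_array (fun x t' => c t' (oapp (g x) false (a t'))) 1.
Proof.
move=> TW rg.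
pose F (tz : T' * 'F_p) := if a tz.1 is Some u then
    if c tz.1 true == tz.2 then (if c tz.1 false == tz.2 then FCst true else FLeaf u)
    else (if c tz.1 false == tz.2 then FNot (FLeaf u) else FCst false)
  else FCst (c tz.1 false == tz.2).
have Fc tz : fsize (F tz) <= level_cost p /\ fdepth (F tz) <= level_cost p.
  have : 3 <= level_cost p by rewrite /level_cost leq_addl.
  rewrite /F; case: (a _) => [u|] /=; last by lia.
  by case: ifP => _; case: ifP => _ /=; lia.
have TF : #|{: T' * 'F_p}| <= W * #|{: 'F_p}| by rewrite card_prod leq_mul.
apply: nc_weaken (nc_level rg TF Fc) => [x [t z]||] /=; rewrite ?mul1n //.
rewrite /F /=; case: (a t) => [u|] //=.
by case: (boolP (c t true == z)) => e1; case: (boolP (c t false == z)) => e2 /=;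
  case: (g x u); rewrite /= ?(negbTE e1) ?(negbTE e2) ?e1 ?e2.
Qed.

Lemma nc_array_test (T' : finType) (tgt : T' -> {set 'F_p}) (h : X -> T' -> 'F_p) l :
  #|T'| <= W -> nc_array h l ->
  nc_realize env m (fun x t' => h x t' \in tgt t')
    (D0 + l.+1 * level_cost p) (s0 + l.+1 * (W * #|{: 'F_p}| * level_cost p)).
Proof.
move=> TW rh.
pose F t := fbigor [seq FLeaf (t, z) | z <- enum (tgt t)].
have Fp0 : 0 < #|{: 'F_p}| by apply/card_gt0P; exists 0%R.
have Fc t : fsize (F t) <= level_cost p /\ fdepth (F t) <= level_cost p.
  have sz : size (enum (tgt t)) <= #|{: 'F_p * 'F_p}|.
    rewrite -cardE (leq_trans (max_card _)) // card_prod.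
    by rewrite -[X in X <= _]muln1 leq_mul2l Fp0 orbT.
  rewrite /F /level_cost; split.
    apply: leq_trans (fsize_bigor (k := 0) _) _; first by rewrite all_map; apply/allP.
    by rewrite size_map muln1 leq_add2r (leq_trans sz) // leq_pmull.
  apply: leq_trans (fdepth_bigor (k := 0) _) _; first by rewrite all_map; apply/allP.
  by rewrite size_map; move: sz; lia.
have TF : #|T'| <= W * #|{: 'F_p}| by apply: leq_trans TW _; rewrite -{1}[W]muln1 leq_mul2l Fp0 orbT.
apply: nc_weaken (nc_level rh TF Fc) => [x t||].
- rewrite /F feval_bigor has_map; apply/hasP/idP => [[z]|ht].
    by rewrite mem_enum => zt /eqP /= ->.
  by exists (h x t); rewrite ?mem_enum //= eqxx.
- by rewrite mulSn addnCA addnC.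
- by rewrite mulSn addnCA addnC.
Qed.
End FieldArrays.

(** Building the matrices with loops takes [L + 3] levels, each of the [L] squarings takes [L.+2]
    (one for products, [L.+1] for sums), and the target test takes one. The width [N.+1 ^ 4] counts
    gates, rows, columns and summation indices. *)
Lemma nc_babp_layer (X : Type) (env : X -> seq bool) m p N L M D s (ys : X -> seq bool)
    (gs : seq (babp p)) (g0 : babp p) :
  0 < m -> N.+1 <= 2 ^ L -> size gs <= N.+1 -> all (babp_wf M) gs ->
  all (fun g => babp_size g <= N.+1) gs ->
  nc_realize env m (fun x (r : 'I_M) => nth false (ys x) r) D s ->
  nc_realize env m (fun x (i : 'I_(size gs)) => babp_eval (fun j => nth false (ys x) j) (nth g0 gs i))
    (D + L.+2 ^ 2 * level_cost p) (s + L.+2 ^ 2 * (N.+1 ^ 4 * #|{: 'F_p}| * level_cost p)).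
Proof.
move=> m0 NL GN gwf gsz rg.
pose K : finType := ('I_(size gs) * 'I_N.+1 * 'I_N.+1)%type.
pose gt (t : K) := nth g0 gs t.1.1.
have gtwf t : babp_wf M (gt t) by apply: (all_nthP g0 gwf); apply: ltn_ord.
have KW : #|K| * N.+1 <= N.+1 ^ 4.
  by rewrite !card_prod !card_ord (_ : 4 = 1 + 1 + 1 + 1) // !expnD expn1 !leq_mul.
have TW : #|{: K * 'I_N.+1}| <= N.+1 ^ 4 by rewrite card_prod card_ord.
have KW' : #|K| <= N.+1 ^ 4 by apply: leq_trans KW; rewrite -{1}[#|K|]muln1 leq_mul2l orbT.
pose bits x j := nth false (ys x) j.
pose e0 : nat * nat * alabel p := (0, 0, ACst 0%R).
pose edge (te : K * 'I_N.+1) := nth e0 (bedges (gt te.1)) te.2.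
(* An entry of the adjacency matrix is a sum over the edge list, in which edges joining other
   vertices contribute 0. *)
pose hit (te : K * 'I_N.+1) := [&& te.2 < size (bedges (gt te.1)),
  (edge te).1.1 == te.1.1.2 & (edge te).1.2 == te.1.2].
pose src (te : K * 'I_N.+1) : option 'I_M :=
  if hit te then (if (edge te).2 is AVar r then insub r else None) else None.
pose val (te : K * 'I_N.+1) (b : bool) : 'F_p :=
  if hit te then (match (edge te).2 with AVar _ => (b : nat)%:R | ACst c => c end)%R else 0%R.
have r1 := nc_array_of_bits m0 src val TW rg.
have r2 := nc_array_sum m0 KW NL r1.
have gtN t : bnv (gt t) <= N.+1 /\ size (bedges (gt t)) <= N.+1.
  have : babp_size (gt t) <= N.+1 by apply: (all_nthP g0 gsz); apply: ltn_ord.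
  by rewrite /babp_size; lia.
have adjE x t : (\sum_k val (t, k) (oapp (bits x) false (omap (nat_of_ord (n:=M)) (src (t, k)))))%R
    = abp_adj N (gt t) (bits x) t.1.2 t.2.
  pose F k := (if ((nth e0 (bedges (gt t)) k).1.1 == t.1.2) && ((nth e0 (bedges (gt t)) k).1.2 == t.2)
    then alab_val (bits x) (nth e0 (bedges (gt t)) k).2 else 0)%R.
  transitivity (\sum_(k < size (bedges (gt t))) F k)%R; last first.
    by rewrite mxE (big_nth e0) big_mkord [RHS]big_mkcond.
  rewrite (big_ord_widen N.+1 F) /F; last by case: (gtN t).
  rewrite [RHS]big_mkcond /=; apply: eq_bigr => k _; rewrite /val /src /hit /edge /=.
  have [kE|kE] := ltnP k (size (bedges (gt t))) => //=; case: ifP => // hk.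
  have := gtwf t => /andP[_] /(all_nthP e0) /(_ k kE) /andP[_].
  by case: (nth e0 _ _).2 => //= r rM; rewrite hk insubT.
have r3 := nc_array_map2 m0 id id
  (fun (t : K) (z _ : 'F_p) => if (t.1.2 == abp_sink N (gt t)) && (t.2 == abp_sink N (gt t)) then (z + 1)%R else z)
  KW' r2.
pose B x t := abp_loop N (gt t) (bits x).
have r4 : nc_array env m (N.+1 ^ 4) D s (fun x (t : K) => B x t t.1.2 t.2) (L + 3).
  rewrite (_ : L + 3 = (1 + L.+1).+1); last by lia.
  apply: nc_array_ext r3 => x t /=; rewrite /B /abp_loop mxE -adjE mxE.
  have -> : (\sum_k val (t, k) (oapp (fun r : 'I_M => nth false (ys x) r) false (src (t, k))) =
     \sum_k val (t, k) (oapp (bits x) false (omap (nat_of_ord (n:=M)) (src (t, k)))))%R.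
    by apply: eq_bigr => k _; case: (src _).
  by case: ifP => //= _; rewrite addr0.
have r5 l : nc_array env m (N.+1 ^ 4) D s (fun x (t : K) => (B x t ^+ (2 ^ l))%R t.1.2 t.2) (L + 3 + l * L.+2).
  elim: l => [|l IH]; first by rewrite mul0n addn0; apply: nc_array_ext r4 => x t; rewrite expr1.
  have q1 := nc_array_map2 m0 (fun tk : K * 'I_N.+1 => (tk.1.1.1, tk.1.1.2, tk.2) : K)
    (fun tk => (tk.1.1.1, tk.2, tk.1.2) : K) (fun _ z1 z2 => (z1 * z2)%R) TW IH.
  have := nc_array_sum m0 KW NL q1.
  rewrite (_ : (L + 3 + l * L.+2).+1 + L.+1 = L + 3 + l.+1 * L.+2); last by rewrite mulSn; lia.
  apply: nc_array_ext => x [[i a] b] /=.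
  by rewrite expnS mul2n -addnn exprD mxE.
have r7 := @nc_array_test X env m p (N.+1 ^ 4) D s m0 'I_(size gs) (fun i => btarget (nth g0 gs i))
  (fun x i => (B x (i, ord0, abp_sink N (nth g0 gs i)) ^+ (2 ^ L))%R ord0 (abp_sink N (nth g0 gs i)))
  (L + 3 + L * L.+2).
have LL : (L + 3 + L * L.+2).+1 <= L.+2 ^ 2 by rewrite expnS expn1; lia.
apply: nc_weaken (r7 _ _).
- move=> x i; have [gN _] := gtN (i, ord0, ord0).
  by rewrite /babp_eval /B (abp_loop_value _ (gtwf (i, ord0, ord0)) gN NL).
- by rewrite leq_add2l leq_mul2r LL orbT.
- by rewrite leq_add2l leq_mul2r LL orbT.
- by rewrite card_ord (leq_trans GN) // -{1}[N.+1]expn1 leq_pexp2l.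
have := nc_reindex (fun iz : 'I_(size gs) * 'F_p => ((iz.1, ord0, abp_sink N (nth g0 gs iz.1)) : K, iz.2)) (r5 L).
by [].
Qed.

Lemma nvals_leaves ms l : nvals ms [seq NLeaf j | j <- l] = [seq nth false ms j | j <- l].
Proof. by elim/last_ind: l => // l j IH; rewrite !map_rcons nvals_rcons IH. Qed.

Lemma ndepths_leaves l : ndepths [seq NLeaf j | j <- l] = nseq (size l) 0.
Proof.
elim/last_ind: l => // l j IH.
by rewrite map_rcons ndepths_rcons IH size_rcons -[in RHS]addn1 nseqD cats1.
Qed.

(** * Layered circuits in NC^2 *)

Section ItToNc.
Variables (ps : seq nat) (n : nat) (C : itcirc ps) (N L : nat).
Hypothesis n0 : 0 < n.
Hypothesis Cwf : it_wf n C.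
Hypothesis CN : it_size C <= N.
Hypothesis NL : N.+1 <= 2 ^ L.

(** Summing over all primes gives one bound for every layer, independent of the word length. *)
Definition primes_cost := \sum_(p <- ps) #|{: 'F_p}| * level_cost p.

Definition it_width m := if m is 0 then size (imono C) else size (ilayers C (size ps - m)).

(* The extra input keeps the monotone part nonempty, as constants need a leaf. *)
Definition padded_mono := rcons (imono C) (MIn 0).

Lemma layer_size_leq k : k < size ps -> \sum_(g <- ilayers C k) babp_size g <= N.
Proof.
move=> kps; apply: leq_trans CN; rewrite /it_size (bigD1 (Ordinal kps)) //=.
by rewrite addnCA leq_addr.
Qed.

Lemma prime_cost_leq k : k < size ps ->
  #|{: 'F_(nth 2 ps k)}| * level_cost (nth 2 ps k) <= primes_cost.
Proof.
move=> kps; rewrite /primes_cost (big_nth 2) big_mkord (bigD1 (Ordinal kps)) //=.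
exact: leq_addr.
Qed.

Lemma it_vals_shallow m : m <= size ps ->
  nc_realize (fun x => mvals x padded_mono) (size padded_mono)
    (fun x (r : 'I_(it_width m)) => nth false (it_vals C x m) r)
    (m * (L.+2 ^ 2 * primes_cost))
    (size (imono C) + m * (L.+2 ^ 2 * (N.+1 ^ 4 * primes_cost))).
Proof.
have pm0 : 0 < size padded_mono by rewrite size_rcons.
elim: m => [_|m IH mps].
  exists [seq NLeaf j | j <- iota 0 (size (imono C))], (fun r => r : nat); split.
  - move=> k; rewrite size_map size_iota => klt.
    rewrite (nth_map 0) ?size_iota // nth_iota //=; rewrite size_rcons; exact: ltnW.
  - by rewrite size_map size_iota mul0n addn0.
  - by move=> r; rewrite size_map size_iota; exact: (ltn_ord r).
  - by move=> r; rewrite ndepths_leaves nth_nseq; case: ifP.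
  - move=> x r; have rlt : r < size (imono C) := ltn_ord r.
    rewrite nvals_leaves (nth_map 0) ?size_iota // nth_iota // add0n.
    by rewrite /padded_mono -cats1 nth_mvals_cat.
have := IH (ltnW mps); rewrite /it_width.
set k := size ps - m.+1; have kps : k < size ps by rewrite /k; lia.
pose g0 := @Babp (nth 2 ps k) 0 [::] set0.
have [_ _ /(_ k kps) wfk] := Cwf.
have km : k.+1 = size ps - m by rewrite /k; lia.
have wfm : all (babp_wf (it_width m)) (ilayers C k).
  move: wfk; rewrite km /it_width; case: (m) mps km => [|m'] mps' km'.
    by rewrite subn0 ltnn.
  by rewrite (_ : size ps - m'.+1 < size ps) //; lia.
have := layer_size_leq kps; set gs := ilayers C k => gsN.
have gsz : all (fun g => babp_size g <= N.+1) gs.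
  elim: (gs) gsN => //= g l IHl; rewrite big_cons => lN.
  by rewrite IHl ?andbT //; lia.
have gsc : size gs <= N.+1.
  apply: leqW; apply: leq_trans gsN; rewrite -sum1_size.
  have : all (babp_wf (it_width m)) gs := wfm.
  elim: (gs) => [|g l IHl] /=; first by rewrite !big_nil.
  move=> /andP[/andP[g1 _] /IHl]; rewrite !big_cons /babp_size; lia.
move=> r; have := nc_babp_layer g0 pm0 NL gsc wfm gsz r.
apply: nc_weaken => [x i||].
- by rewrite [it_vals _ _ _.+1]/= -/k -/gs (nth_map g0).
- rewrite mulSn addnC leq_add2r leq_mul2l; apply/orP; right.
  apply: leq_trans (prime_cost_leq kps); rewrite -{1}[level_cost _]mul1n leq_mul2r.
  by apply/orP; right; apply/card_gt0P; exists 0%R.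
rewrite mulSn -addnA leq_add2l addnC leq_add2r leq_mul2l; apply/orP; right.
by rewrite -mulnA leq_mul2l; apply/orP; right; apply: prime_cost_leq.
Qed.

Lemma nc_size_leq (Cn : nccirc) : nc_size Cn <= msize (nmono Cn) + 3 * size (ngates Cn).
Proof.
rewrite /nc_size -addnA leq_add2l mulSn leq_add2l -sum1_size big_distrr /=.
by apply: leq_sum => -[].
Qed.

Lemma it_to_nc : 0 < size ps -> exists Cn, [/\ nc_wf n Cn,
  nc_size Cn <= N + 1 + 3 * (N + size ps * (L.+2 ^ 2 * (N.+1 ^ 4 * primes_cost)) + 1),
  nc_depth Cn <= size ps * (L.+2 ^ 2 * primes_cost) + 1 &
  forall b, nc_accepts Cn b = it_accepts C b].
Proof.
move=> ps0; have [C0 Cm _] := Cwf.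
have w1 : it_width (size ps) = 1 by rewrite /it_width subnn C0; case: (size ps) ps0.
have := it_vals_shallow (leqnn _); rewrite w1.
move=> [c [pos [wfc sc pc pd pv]]].
pose p := pos ord0.
have sm : msize (imono C) <= N by apply: leq_trans CN; rewrite /it_size leq_addr.
(* The output is read at the last gate, so the result at [p] is moved there by a conjunction with
   itself. *)
exists (NcCirc padded_mono (rcons c (NAnd p p))); split.
- split=> /=; [exact: mcirc_wf_rcons|by rewrite size_rcons|].
  by apply: ngates_wf_rcons => //=; rewrite pc.
- apply: leq_trans (nc_size_leq _) _; apply: leq_add => /=.
    by rewrite /msize size_rcons big_rcons /= addn0 addSn addn1 ltnS; apply: sm.
  rewrite leq_mul2l /= size_rcons addn1 ltnS; apply: leq_trans sc _.
  by rewrite leq_add2r; apply: leq_trans sm; rewrite /msize leq_addr.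
- by rewrite /nc_depth ndepths_rcons last_rcons /= maxnn addn1 ltnS pd.
move=> b; rewrite /nc_accepts nvals_rcons last_rcons /= andbb.
exact: (pv (fun j => nth false b j)).
Qed.
End ItToNc.

(** Since [n ^ e] is positive, [c * n ^ e + c + 1] is at most [(2 * c + 1) * n ^ e], whose logarithm
    is linear in that of [n]. *)
Lemma trunc_log_poly c e n : 0 < n ->
  trunc_log 2 (c * n ^ e + c).+1 <= 2 * c + 1 + (trunc_log 2 n).+1 * e.
Proof.
move=> n0; have n2 : n <= 2 ^ (trunc_log 2 n).+1 by rewrite ltnW // trunc_log_ltn.
rewrite -(@leq_exp2l 2) //; apply: leq_trans (trunc_logP _ _) _ => //.
rewrite expnD; have ne : n ^ e <= 2 ^ ((trunc_log 2 n).+1 * e).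
  by rewrite expnM; case: (e) => // e'; rewrite leq_exp2r.
have ne0 : 0 < n ^ e by rewrite expn_gt0 n0.
apply: (@leq_trans ((2 * c + 1) * n ^ e)); first by nia.
by apply: leq_mul => //; apply: ltnW; apply: ltn_expl.
Qed.

Theorem nuItDet_NC2 L : nuItDet_MONOTONE L -> NC2_MONOTONE L.
Proof.
move=> [ps [ps0 [_ [C [c [e CP]]]]]].
pose N n := c * n ^ e + c; pose P := primes_cost ps.
have CnP n : exists Cn, 0 < n -> [/\ nc_wf n Cn,
    nc_size Cn <= N n + 1 + 3 * (N n + size ps * ((N n + 4) ^ 2 * ((N n + 1) ^ 4 * P)) + 1),
    nc_depth Cn <= size ps * ((trunc_log 2 (N n).+1 + 3) ^ 2 * P) + 1 &
    forall b, nc_accepts Cn b = it_accepts (C n) b].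
  have [n0|n0] := posnP n; first by exists (NcCirc [::] [::]); rewrite n0.
  have [Cwf [Cs _]] := CP n n0.
  have NL : (N n).+1 <= 2 ^ (trunc_log 2 (N n).+1).+1 by rewrite ltnW // trunc_log_ltn.
  have [Cn [wf s d a]] := it_to_nc n0 Cwf Cs NL ps0.
  have tl : trunc_log 2 (N n).+1 <= (N n).+1.
    by rewrite ltnW // (leq_trans _ (trunc_logP (p := 2) _ _)) // ltn_expl.
  exists Cn => _; split=> //; last by rewrite addn3.
  apply: leq_trans s _; rewrite leq_add2l leq_mul2l /= leq_add2r leq_add2l leq_mul2l.
  apply/orP; right; rewrite addn1 leq_mul2r; apply/orP; right.
  by rewrite leq_exp2r // addn4 !ltnS.
have [Cn CnE] := choice CnP.
have [c1 [e1 s1]] : exists c1 e1, forall n, 0 < n ->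
    N n + 1 + 3 * (N n + size ps * ((N n + 4) ^ 2 * ((N n + 1) ^ 4 * P)) + 1) <= c1 * n ^ e1 + c1.
  apply: polybound_std; rewrite /N.
  by repeat first [exact: polybound_cst | exact: polybound_id | apply: polybound_add
    | apply: polybound_mul | apply: polybound_exp].
(* Chosen so that [trunc_log_poly] bounds [t + 3] by [a + l * e], with [l] the logarithm of [n];
   [c2] then comes from bounding the square of this sum by twice the sum of the squares. *)
pose a := 2 * c + 4 + e.
pose c2 := size ps * P * (2 * a ^ 2 + 2 * e ^ 2) + 1.
exists Cn, (c1 + c2), e1 => n n0; have [wf s d ac] := CnE n n0.
split=> //; split; [|split].
- apply: leq_trans s _; apply: leq_trans (s1 n n0) _.
  by rewrite leq_add ?leq_addr // leq_mul2r leq_addr orbT.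
- apply: leq_trans d _; have := trunc_log_poly c e n0; rewrite -/(N n).
  set t := trunc_log 2 _; set l := trunc_log 2 n => tl.
  have tb : t + 3 <= a + l * e by rewrite /a; lia.
  have : (t + 3) ^ 2 <= 2 * a ^ 2 + 2 * (l * e) ^ 2.
    by apply: (@leq_trans ((a + l * e) ^ 2)); [rewrite leq_exp2r|rewrite sqrnD; have [] := nat_Cauchy a (l * e); lia].
  rewrite expnMn => tb2.
  apply: (@leq_trans (c2 * l ^ 2 + c2)); last by rewrite leq_add ?leq_addl // leq_mul2r leq_addl orbT.
  apply: (@leq_trans (size ps * P * (2 * a ^ 2 + 2 * (l ^ 2 * e ^ 2)) + 1)).
    by rewrite leq_add2r -mulnA leq_mul2l mulnC leq_mul2l tb2 !orbT.
  by rewrite /c2; move: (size ps * P) (a ^ 2) (e ^ 2) (l ^ 2) => *; nia.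
by move=> b sb; have [_ [_ acc]] := CP n n0; rewrite ac; apply: acc.
Qed.

Theorem mainTheorem17 (I : finType) (ar : I -> nat) (A : finAlg ar)
  (beta : rel (fcar A)) :
  cm_variety A ->
  typ_sub24 A ->
  is_con A beta ->
  typ_eq4 (quot A beta) ->
  (forall g d, prime_quot A g d -> subrel d beta -> type2 A g d) ->
  subdirect_tot (quot A beta) ->
  (forall L : lang, nuP A L -> nuItDet_MONOTONE L) /\
  (forall L : lang, nuP A L -> NC2_MONOTONE L).
Proof.
move=> _ _ bcon _ btype bsub.
have nup := nuP_nuItDet bcon btype bsub.
by split=> L /nup //; exact: nuItDet_NC2.
Qed.
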